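(* Let $\mathsf V$ be a pseudovariety of semigroups containing $\mathcal{L}\mathsf{Sl}$ and such that $\mathsf V=\mathsf V\ast\mathsf D$. If $\mathcal X$ and $\mathcal Y$ are conjugate subshifts (over possibly different alphabets), then $\mathbb K(\mathcal M_{\mathsf V}(\mathcal X))$ and $\mathbb K(\mathcal M_{\mathsf V}(\mathcal Y))$ are isomorphic compact categories.
   Context: Alphabets are finite nonempty sets; $A^+$ is the free semigroup on $A$. Compact spaces are Hausdorff. A pseudovariety of semigroups is a class of finite semigroups closed under subsemigroups, homomorphic images and finite direct products. $\mathcal L\mathsf{Sl}$ is the class of finite semigroups $S$ such that $eSe$ is a semilattice (commutative, all elements idempotent) for every idempotent $e$ of $S$. $\mathsf D$ is the class of finite semigroups $S$ with $Se=\{e\}$ for every idempotent $e$ of $S$. $\mathsf V\ast\mathsf W$ is the least pseudovariety containing all semidirect products (for left actions) of an element of $\mathsf V$ with an element of $\mathsf W$. $\widehat F_{\mathsf V}(A)$ is the free pro-$\mathsf V$ semigroup on $A$, i.e. the inverse limit of the finite quotients of $A^+$ belonging to $\mathsf V$. If $\mathsf V\supseteq\mathcal L\mathsf{Sl}$, $A^+$ embeds in it as a dense subsemigroup of isolated points. A subshift of $A^{\mathbb Z}$ is a nonempty closed set $\mathcal X\subseteq A^{\mathbb Z}$ with $\sigma_A(\mathcal X)=\mathcal X$, where $\sigma_A((x_i)_i)=(x_{i+1})_i$. $L(\mathcal X)\subseteq A^+$ is the set of nonempty finite words occurring in elements of $\mathcal X$. Two subshifts are conjugate if there is a homeomorphism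 between them commuting with the shift maps. The mirage $\mathcal M_{\mathsf V}(\mathcal X)$ is the set of $u\in\widehat F_{\mathsf V}(A)$ all of whose factors in $A^+$ belong to $L(\mathcal X)$. A compact category is a small category whose sets of objects and of arrows are compact spaces such that domain, codomain, $x\mapsto 1_x$, and composition are continuous. Morphisms of compact categories are functors continuous on objects and on arrows. For a compact semigroup $S$, the Karoubi envelope $\mathbb K(S)$ has as objects the idempotents of $S$, and as arrows $f\to e$ the triples $(e,s,f)$ with $s\in S$, $s=esf$; composition is $(e,s,f)(f,t,g)=(e,st,g)$ and topologies are induced from $S$ and $S\times S\times S$. $\mathbb K(\mathcal M_{\mathsf V}(\mathcal X))$ is the compact subcategory of $\mathbb K(\widehat F_{\mathsf V}(A))$ whose objects are the idempotents in $\mathcal M_{\mathsf V}(\mathcal X)$ and whose arrows are the $(e,u,f)$ with $u\in\mathcal M_{\mathsf V}(\mathcal X)$. *)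

(* Defs.v *)
From HB Require Import structures.
From mathcomp Require Import all_boot all_order all_algebra.
From mathcomp Require Import generic_quotient.
From mathcomp Require Import all_classical all_reals all_analysis.

Set Implicit Arguments.
Unset Strict Implicit.
Unset Printing Implicit Defensive.

Local Open Scope classical_set_scope.
Local Open Scope quotient_scope.
Local Open Scope group_scope.

(** * General topology *)

Lemma closed_equalizer (T U : topologicalType) (f g : T -> U) :
  hausdorff_space U -> continuous f -> continuous g ->
  closed [set x | f x = g x].
Proof.
move=> hU cf cg x clx; apply: hU => P Q Pf Qg.
have [y [/= fg [Py Qy]]] :=
  clx _ (@filterI _ (nbhs x) _ _ _ (cf x P Pf) (cg x Q Qg)).
by exists (f y); split; [exact: Py | rewrite fg; exact: Qy].
Qed.

Lemma hausdorff_inj (T U : topologicalType) (f : T -> U) :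
  injective f -> continuous f -> hausdorff_space U -> hausdorff_space T.
Proof.
move=> fI cf hU x y xy; apply: fI; apply: hU => P Q Pf Qf.
by have [z [Pz Qz]] := xy _ _ (cf x P Pf) (cf y Q Qf); exists (f z).
Qed.

Lemma set_val_continuous (T : topologicalType) (A : set T) :
  continuous (set_val : A -> T).
Proof. exact: initial_continuous. Qed.

Lemma hausdorff_set_type (T : topologicalType) (A : set T) :
  hausdorff_space T -> hausdorff_space (A : Type).
Proof.
move=> hT.
exact: (@hausdorff_inj _ _ set_val val_inj (@set_val_continuous T A) hT).
Qed.

Lemma compact_set_type (T : topologicalType) (A : set T) :
  compact A -> compact [set: A].
Proof.
move=> cA F PF FT.
have GA : (set_val @ F) A.
  by apply: (@filterS _ F _ setT) FT => x _; exact: set_valP.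
have [a [Aa cla]] := cA _ _ GA.
exists (SigSub (mem_set Aa)); split => // P Q FP [_ [[W oW <-] /= Wa WQ]].
have FP' : (set_val @ F) (set_val @` P).
  by apply: (@filterS _ F _ P) FP => x Px; exists x.
have [_ [[p Pp <-] Wp]] := cla _ W FP' (open_nbhs_nbhs (conj oW Wa)).
by exists p; split => //; apply: WQ.
Qed.

Lemma continuous_to_set_type (T U : topologicalType) (A : set U) (f : T -> A) :
  continuous (set_val \o f) -> continuous f.
Proof. exact: continuous_comp_initial. Qed.

Lemma continuous_pair (T U W : topologicalType) (f : T -> U) (g : T -> W) :
  continuous f -> continuous g -> continuous (fun x => (f x, g x)).
Proof. by move=> cf cg x; apply: cvg_pair; [exact: cf | exact: cg]. Qed.

Lemma continuous_fst (T U : topologicalType) : continuous (@fst T U).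
Proof. by move=> x; exact: cvg_fst. Qed.

Lemma continuous_snd (T U : topologicalType) : continuous (@snd T U).
Proof. by move=> x; exact: cvg_snd. Qed.

Lemma continuous_compo (T U W : topologicalType) (f : T -> U) (g : U -> W) :
  continuous f -> continuous g -> continuous (g \o f).
Proof. by move=> cf cg x; apply: continuous_comp; [exact: cf | exact: cg]. Qed.

Lemma compact_setTX (T U : topologicalType) :
  compact [set: T] -> compact [set: U] -> compact [set: T * U].
Proof. by move=> cT cU; rewrite -setXTT; exact: compact_setX. Qed.

Lemma hausdorff_setX (T U : topologicalType) :
  hausdorff_space T -> hausdorff_space U -> hausdorff_space (T * U)%type.
Proof.
move=> hT hU [x1 x2] [y1 y2] xy; congr (_, _).
- apply: hT => P Q Px Qy.
  have [||z [Pz Qz]] := xy (fst @^-1` P) (fst @^-1` Q).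
  + exact: (@continuous_fst T U (x1, x2) _ Px).
  + exact: (@continuous_fst T U (y1, y2) _ Qy).
  by exists z.1.
- apply: hU => P Q Px Qy.
  have [||z [Pz Qz]] := xy (snd @^-1` P) (snd @^-1` Q).
  + exact: (@continuous_snd T U (x1, x2) _ Px).
  + exact: (@continuous_snd T U (y1, y2) _ Qy).
  by exists z.2.
Qed.

(** * Compact semigroups *)

HB.mixin Record isCompactSemigroup S of Topological S & Semigroup S := {
  compact_semigroup : compact [set: S];
  hausdorff_semigroup : hausdorff_space S;
  continuous_mulg : continuous (fun p : S * S => p.1 * p.2)
}.

#[short(type="compactSemigroupType")]
HB.structure Definition CompactSemigroup :=
  {S of isCompactSemigroup S & Topological S & Semigroup S}.

(** * Finite semigroups and pseudovarieties *)

(* A finite semigroup is allowed to be empty; a pseudovariety in the sense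
   below is one of nonempty finite semigroups together with the empty one. *)
#[short(type="finSemigroupType")]
HB.structure Definition FinSemigroup := {S of Semigroup S & Finite S}.

HB.instance Definition _ (S T : finSemigroupType) :=
  Semigroup.on (S * T)%type.

Record pseudovariety (V : finSemigroupType -> Prop) : Prop := Pseudovariety {
  pseudovariety_sub : forall (S T : finSemigroupType)
    (f : {multiplicative S -> T}), injective f -> V T -> V S;
  pseudovariety_img : forall (S T : finSemigroupType)
    (f : {multiplicative S -> T}), (forall y, exists x, f x = y) -> V S -> V T;
  pseudovariety_prod : forall S T : finSemigroupType,
    V S -> V T -> V (S * T)%type;
  (* the empty direct product *)
  pseudovariety_triv : forall S : finSemigroupType, #|S| = 1%N -> V S
}.

Definition LSl (S : finSemigroupType) : Prop :=
  forall e : S, e * e = e ->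
    (forall x y : S, (e * x * e) * (e * y * e) = (e * y * e) * (e * x * e)) /\
    (forall x : S, (e * x * e) * (e * x * e) = e * x * e).

Definition Dvar (S : finSemigroupType) : Prop :=
  forall e : S, e * e = e -> forall x : S, x * e = e.

(* Left actions by endomorphisms; if T happens to have a unit, it is not
   required to act as the identity. *)
Record left_action (S T : semigroupType) := LeftAction {
  lact :> T -> S -> S;
  lactM : forall t, {morph lact t : x y / x * y};
  lactA : forall t t' s, lact (t * t') s = lact t (lact t' s)
}.

Definition semidirect (S T : semigroupType) (a : left_action S T) : Type :=
  (S * T)%type.

Section Semidirect.
Variables (S T : semigroupType) (a : left_action S T).

Definition semidirect_mul (p q : semidirect a) : semidirect a :=
  (p.1 * a p.2 q.1, p.2 * q.2).

Lemma semidirect_mulA : associative semidirect_mul.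
Proof.
by move=> p q r; rewrite /semidirect_mul /= lactM -lactA !mulgA.
Qed.

HB.instance Definition _ := Choice.on (semidirect a).
HB.instance Definition _ := isSemigroup.Build (semidirect a) semidirect_mulA.
End Semidirect.

HB.instance Definition _ (S T : finSemigroupType) (a : left_action S T) :=
  Finite.copy (semidirect a) (S * T)%type.

(* The pseudovariety V * W generated by the semidirect products of a member
   of V by a member of W. *)
Definition semidirect_var (V W : finSemigroupType -> Prop)
    (U : finSemigroupType) : Prop :=
  forall P : finSemigroupType -> Prop, pseudovariety P ->
    (forall (S T : finSemigroupType) (a : left_action S T),
      V S -> W T -> P (semidirect a)) ->
    P U.

(** * Words *)

Section Words.
Variable A : finType.

Definition word := {s : seq A | s != [::]}.
HB.instance Definition _ := SubChoice.on word.

Lemma word_mul_subproof (u v : word) : val u ++ val v != [::].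
Proof. by case: u => [[|x s]]. Qed.

Definition word_mul (u v : word) : word :=
  exist _ (val u ++ val v) (word_mul_subproof u v).

Lemma word_mulA : associative word_mul.
Proof. by move=> u v w; apply: val_inj; rewrite /= catA. Qed.

HB.instance Definition _ := isSemigroup.Build word word_mulA.
End Words.

(** * Quotients of a semigroup and its pro-V completion *)

Record congruence (M : semigroupType) := Congruence {
  cong_rel :> equiv_rel M;
  congM : forall u u' v v' : M,
    cong_rel u u' -> cong_rel v v' -> cong_rel (u * v) (u' * v')
}.

Section Quotient.
Variables (M : semigroupType) (th : congruence M).

Definition quot : Type := {eq_quot (cong_rel th)}.
HB.instance Definition _ := Choice.on quot.
HB.instance Definition _ := EqQuotient.on quot.

Definition quot_mul : quot -> quot -> quot := lift_op2 quot (fun x y => x * y).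

Lemma quot_pi_mul : {morph \pi_quot : x y / x * y >-> quot_mul x y}.
Proof.
move=> x y; unlock quot_mul; apply/eqmodP; apply: congM.
- by apply/eqmodP; rewrite reprK.
- by apply/eqmodP; rewrite reprK.
Qed.

Lemma quot_mulA : associative quot_mul.
Proof.
move=> x y z; rewrite -[x]reprK -[y]reprK -[z]reprK.
by rewrite -!quot_pi_mul mulgA.
Qed.

HB.instance Definition _ := isSemigroup.Build quot quot_mulA.
End Quotient.

(* The quotients of M that are finite and belong to V, up to isomorphism. *)
Record vquot (V : finSemigroupType -> Prop) (M : semigroupType) := VQuot {
  vquot_cong :> congruence M;
  vquotP : exists2 S : finSemigroupType, V S &
    exists f : {multiplicative quot vquot_cong -> S}, bijective f
}.

HB.instance Definition _ V M := gen_eqMixin (vquot V M).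

Section Completion.
Variables (V : finSemigroupType -> Prop) (M : semigroupType).

Definition vquot_prod : topologicalType :=
  prod_topology (fun th : vquot V M => discrete_topology (quot th)).

(* Compatibility with the canonical maps M/th -> M/th' for th included
   in th'. *)
Definition compatible : set vquot_prod :=
  [set u | forall th th' : vquot V M, (forall x y, th x y -> th' x y) ->
     forall w : M, u th = \pi_(quot th) w -> u th' = \pi_(quot th') w].

(* The inverse limit of the quotients of M belonging to V. *)
Definition completion : Type := set_type compatible.
End Completion.

Section CompletionMul.
Variables (V : finSemigroupType -> Prop) (M : semigroupType).
Implicit Types u v : completion V M.

Lemma completion_mul_subproof u v :
  compatible ((fun th : vquot V M =>
    (val u th : quot th) * (val v th : quot th)) : vquot_prod V M).
Proof.
move=> th th' sth w.
rewrite -[val u th](@reprK _ (quot th)) -[val v th](@reprK _ (quot th)).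
set a := repr (val u th); set b := repr (val v th) => abw.
have ua : val u th' = \pi_(quot th') a.
  by apply: (@set_valP _ _ u _ _ sth); rewrite reprK.
have vb : val v th' = \pi_(quot th') b.
  by apply: (@set_valP _ _ v _ _ sth); rewrite reprK.
rewrite ua vb -[LHS]quot_pi_mul; apply/eqmodP; apply: sth; apply/eqmodP.
by rewrite quot_pi_mul.
Qed.

Definition completion_mul u v : completion V M :=
  SigSub (mem_set (@completion_mul_subproof u v)).

Lemma completion_mulA : associative completion_mul.
Proof.
move=> u v w; apply: val_inj; apply: functional_extensionality_dep => th /=.
exact: mulgA.
Qed.

HB.instance Definition _ := Topological.on (completion V M).
HB.instance Definition _ := isSemigroup.Build (completion V M) completion_mulA.
End CompletionMul.

Section CompletionTopology.
Variables (V : finSemigroupType -> Prop) (M : semigroupType).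

Lemma vquot_proj_continuous (th : vquot V M) :
  continuous (fun u : vquot_prod V M => u th).
Proof. exact: (@proj_continuous (vquot V M) _ th). Qed.

Lemma vquot_prod_continuous (T : topologicalType) (f : T -> vquot_prod V M) :
  (forall th, continuous (fun x => f x th)) -> continuous f.
Proof.
move=> cf x; apply/cvg_sup => th; move: x.
by apply: continuous_comp_initial; exact: cf.
Qed.

Lemma compact_quot (th : vquot V M) :
  compact [set: discrete_topology (quot th)].
Proof.
apply: finite_compact; have [S _ [f bf]] := vquotP th.
have fI : injective f := bij_inj bf.
rewrite -(preimage_setT f); apply: finite_preimage; last exact: finite_finset.
by move=> x y _ _; exact: fI.
Qed.

Lemma compatible_closed : closed (@compatible V M).
Proof.
have -> : @compatible V M = \bigcap_(p in [set p : vquot V M * vquot V M |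
    forall x y, p.1 x y -> p.2 x y]) \bigcap_(w in [set: M])
    [set u : vquot_prod V M | u p.1 = \pi_(quot p.1) w ->
                              u p.2 = \pi_(quot p.2) w].
  apply/seteqP; split=> u /= cu.
    by move=> [th th'] /= sth w _; exact: cu.
  by move=> th th' sth w; exact: (cu (th, th') sth w).
apply: closed_bigI => -[th th'] _; apply: closed_bigI => w _ /=.
have -> : [set u : vquot_prod V M | u th = \pi_(quot th) w ->
                              u th' = \pi_(quot th') w] =
   (fun u : vquot_prod V M => u th) @^-1` (~` [set \pi_(quot th) w]) `|`
   (fun u : vquot_prod V M => u th') @^-1` [set \pi_(quot th') w].
  apply/seteqP; split=> u /=; last by case.
  move=> h; have [e|ne] := pselect (u th = \pi_(quot th) w); last by left.
  by right; exact: h.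
apply: closedU.
- apply: preimage_closed; first by move=> u _; exact: vquot_proj_continuous.
  exact: (@discrete_closed (discrete_topology (quot th))).
- apply: preimage_closed; first by move=> u _; exact: vquot_proj_continuous.
  exact: (@discrete_closed (discrete_topology (quot th'))).
Qed.

Lemma compact_completion : compact [set: completion V M].
Proof.
apply: compact_set_type; apply: subclosed_compact compatible_closed _ _.
  exact: (@tychonoff (vquot V M) _ (fun th => setT) compact_quot).
by [].
Qed.

Lemma hausdorff_completion : hausdorff_space (completion V M).
Proof.
apply: hausdorff_set_type; apply: (@hausdorff_product (vquot V M)) => th.
exact: discrete_hausdorff.
Qed.

Lemma continuous_completion_mul :
  continuous (fun p : completion V M * completion V M => p.1 * p.2).
Proof.
apply: continuous_to_set_type; apply: vquot_prod_continuous => th.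
pose pr (u : completion V M) : discrete_topology (quot th) := val u th.
have cpr : continuous pr.
  apply: (@continuous_compo _ _ _ set_val (fun u : vquot_prod V M => u th)).
    exact: set_val_continuous.
  exact: vquot_proj_continuous.
move=> p U /nbhs_singleton Up.
apply: (@filterS _ _ _ [set q : completion V M * completion V M |
    [set pr p.1] (pr q.1) /\ [set pr p.2] (pr q.2)]).
  move=> q [/= e1 e2]; move: Up; congr (U _).
  by congr ((_ : quot th) * (_ : quot th)); exact/esym.
exists (pr @^-1` [set pr p.1], pr @^-1` [set pr p.2]); last by move=> q.
by split; apply: cpr; exact: discrete_set1.
Qed.
End CompletionTopology.

HB.instance Definition _ V M := isCompactSemigroup.Build (completion V M)
  (@compact_completion V M) (@hausdorff_completion V M)
  (@continuous_completion_mul V M).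

Definition free_proV (V : finSemigroupType -> Prop) (A : finType) :
  compactSemigroupType := completion V (word A).

Section WordEmbedding.
Variables (V : finSemigroupType -> Prop) (A : finType).

Lemma free_proV_word_subproof (w : word A) :
  @compatible V (word A) (fun th => \pi_(quot th) w).
Proof.
move=> th th' sth w' /eqmodP thw; apply/eqmodP; exact: sth.
Qed.

Definition free_proV_word (w : word A) : free_proV V A :=
  SigSub (mem_set (@free_proV_word_subproof w)).
End WordEmbedding.

(** * Compact categories *)

(* compose a b is the composite "a after b". *)
Record compactCategory := CompactCategory {
  obj : topologicalType;
  arr : topologicalType;
  dom : arr -> obj;
  cod : arr -> obj;
  idn : obj -> arr;
  compose : forall a b : arr, dom a = cod b -> arr;
  dom_idn : forall x, dom (idn x) = x;
  cod_idn : forall x, cod (idn x) = x;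
  dom_compose : forall a b (h : dom a = cod b), dom (compose h) = dom b;
  cod_compose : forall a b (h : dom a = cod b), cod (compose h) = cod a;
  compose_idl : forall x a (h : dom (idn x) = cod a), compose h = a;
  compose_idr : forall x a (h : dom a = cod (idn x)), compose h = a;
  composeA : forall a b c (ab : dom a = cod b) (bc : dom b = cod c)
    (a_bc : dom a = cod (compose bc)) (ab_c : dom (compose ab) = cod c),
    compose a_bc = compose ab_c;
  compact_obj : compact [set: obj];
  hausdorff_obj : hausdorff_space obj;
  compact_arr : compact [set: arr];
  hausdorff_arr : hausdorff_space arr;
  continuous_dom : continuous dom;
  continuous_cod : continuous cod;
  continuous_idn : continuous idn;
  continuous_compose : continuous
    (fun p : [set p : arr * arr | dom p.1 = cod p.2] => compose (set_valP p))
}.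

Record compact_functor (C D : compactCategory) := CompactFunctor {
  fobj : obj C -> obj D;
  farr : arr C -> arr D;
  fdom : forall a, dom (farr a) = fobj (dom a);
  fcod : forall a, cod (farr a) = fobj (cod a);
  fidn : forall x, farr (idn x) = idn (fobj x);
  fcompose : forall a b (h : dom a = cod b) (h' : dom (farr a) = cod (farr b)),
    farr (compose h) = compose h';
  continuous_fobj : continuous fobj;
  continuous_farr : continuous farr
}.

Definition isomorphic_categories (C D : compactCategory) : Prop :=
  exists (F : compact_functor C D) (G : compact_functor D C),
    [/\ cancel (fobj F) (fobj G), cancel (fobj G) (fobj F),
        cancel (farr F) (farr G) & cancel (farr G) (farr F)].

(** ** Compact subcategories *)

Record compact_subcategory (C : compactCategory)
    (O : set (obj C)) (A : set (arr C)) : Prop := CompactSubcategory {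
  sub_closed_obj : closed O;
  sub_closed_arr : closed A;
  sub_dom : forall a, A a -> O (dom a);
  sub_cod : forall a, A a -> O (cod a);
  sub_idn : forall x, O x -> A (idn x);
  sub_compose : forall a b (h : dom a = cod b), A a -> A b -> A (compose h)
}.

Section Subcategory.
Variables (C : compactCategory) (O : set (obj C)) (A : set (arr C)).
Hypothesis H : compact_subcategory O A.

Definition subcat_dom (a : A) : O :=
  SigSub (mem_set (sub_dom H (set_valP a))).
Definition subcat_cod (a : A) : O :=
  SigSub (mem_set (sub_cod H (set_valP a))).
Definition subcat_idn (x : O) : A :=
  SigSub (mem_set (sub_idn H (set_valP x))).

Lemma subcat_composable (a b : A) :
  subcat_dom a = subcat_cod b -> dom (val a) = cod (val b).
Proof. by move=> /(congr1 val). Qed.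

Definition subcat_compose (a b : A) (h : subcat_dom a = subcat_cod b) : A :=
  SigSub (mem_set
    (sub_compose H (subcat_composable h) (set_valP a) (set_valP b))).

Program Definition subcategory : compactCategory :=
  @CompactCategory O A subcat_dom subcat_cod subcat_idn subcat_compose
    _ _ _ _ _ _ _ _ _ _ _ _ _ _ _.
Next Obligation. by move=> *; apply: val_inj; exact: dom_idn. Qed.
Next Obligation. by move=> *; apply: val_inj; exact: cod_idn. Qed.
Next Obligation. by move=> *; apply: val_inj; exact: dom_compose. Qed.
Next Obligation. by move=> *; apply: val_inj; exact: cod_compose. Qed.
Next Obligation. by move=> *; apply: val_inj; exact: compose_idl. Qed.
Next Obligation. by move=> *; apply: val_inj; exact: compose_idr. Qed.
Next Obligation. by move=> *; apply: val_inj; exact: composeA. Qed.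
Next Obligation.
apply: compact_set_type.
exact: (subclosed_compact (sub_closed_obj H) (@compact_obj C) (@subsetT _ O)).
Qed.
Next Obligation. by apply: hausdorff_set_type; exact: hausdorff_obj. Qed.
Next Obligation.
apply: compact_set_type.
exact: (subclosed_compact (sub_closed_arr H) (@compact_arr C) (@subsetT _ A)).
Qed.
Next Obligation. by apply: hausdorff_set_type; exact: hausdorff_arr. Qed.
Next Obligation.
apply: continuous_to_set_type.
apply: (@continuous_compo _ _ _ (@set_val _ A) (@dom C)).
  exact: set_val_continuous.
exact: continuous_dom.
Qed.
Next Obligation.
apply: continuous_to_set_type.
apply: (@continuous_compo _ _ _ (@set_val _ A) (@cod C)).
  exact: set_val_continuous.
exact: continuous_cod.
Qed.
Next Obligation.
apply: continuous_to_set_type.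
apply: (@continuous_compo _ _ _ (@set_val _ O) (@idn C)).
  exact: set_val_continuous.
exact: continuous_idn.
Qed.
Next Obligation.
apply: continuous_to_set_type.
pose E := [set p : A * A | subcat_dom p.1 = subcat_cod p.2].
pose E' := [set p : arr C * arr C | dom p.1 = cod p.2].
pose j (p : E) : E' := @SigSub _ _ _ (val (val p).1, val (val p).2)
  (mem_set (subcat_composable (set_valP p))).
have cj : continuous j.
  apply: continuous_to_set_type; apply: continuous_pair.
  - apply: (@continuous_compo _ _ _ (fun p : E => (val p).1) (@set_val _ A)).
      apply: (@continuous_compo _ _ _ (@set_val _ E) fst).
        exact: set_val_continuous.
      exact: continuous_fst.
    exact: set_val_continuous.
  - apply: (@continuous_compo _ _ _ (fun p : E => (val p).2) (@set_val _ A)).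
      apply: (@continuous_compo _ _ _ (@set_val _ E) snd).
        exact: set_val_continuous.
      exact: continuous_snd.
    exact: set_val_continuous.
rewrite [X in continuous X](_ : _ = (fun p : E' => compose (set_valP p)) \o j).
  by apply: continuous_compo cj _; exact: continuous_compose.
apply/funext => p /=; congr compose; exact: eq_irrelevance.
Qed.
End Subcategory.

(** * Karoubi envelope *)

Section Karoubi.
Variable S : compactSemigroupType.

Definition idempotents : set S := [set e | e * e = e].

(* The triple (e, s, f) is ((e, s), f). *)
Definition karoubi_arrows : set (S * S * S) :=
  [set t | [/\ idempotents t.1.1, idempotents t.2
             & t.1.2 = t.1.1 * t.1.2 * t.2]].

Definition karoubi_obj : topologicalType := idempotents.
Definition karoubi_arr : topologicalType := karoubi_arrows.
Implicit Types (a b : karoubi_arr) (e : karoubi_obj).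

Definition karoubi_mid a : S := (val a).1.2.

Lemma karoubi_cod_subproof a : idempotents (val a).1.1.
Proof. by case: (set_valP a). Qed.
Lemma karoubi_dom_subproof a : idempotents (val a).2.
Proof. by case: (set_valP a). Qed.

Definition karoubi_cod a : karoubi_obj :=
  SigSub (mem_set (karoubi_cod_subproof a)).
Definition karoubi_dom a : karoubi_obj :=
  SigSub (mem_set (karoubi_dom_subproof a)).

Lemma karoubi_idn_subproof e : karoubi_arrows (val e, val e, val e).
Proof.
have ee : val e * val e = val e := set_valP e.
by split => //=; rewrite !ee.
Qed.

Definition karoubi_idn e : karoubi_arr :=
  SigSub (mem_set (karoubi_idn_subproof e)).

Lemma karoubi_compose_subproof a b : karoubi_dom a = karoubi_cod b ->
  karoubi_arrows ((val a).1.1, karoubi_mid a * karoubi_mid b, (val b).2).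
Proof.
move=> _; case: (set_valP a) (set_valP b) => [ea fa sa] [eb fb sb].
split => //=; rewrite /karoubi_mid [in LHS]sa [in LHS]sb [in RHS]sa [in RHS]sb.
rewrite !mulgA; rewrite /idempotents /= in ea fb.
by rewrite ea -[in RHS](mulgA _ (val b).2) fb.
Qed.

Definition karoubi_compose a b (h : karoubi_dom a = karoubi_cod b) :
    karoubi_arr :=
  SigSub (mem_set (karoubi_compose_subproof h)).

Lemma karoubi_arr_eq a b : (val a).1.1 = (val b).1.1 ->
  karoubi_mid a = karoubi_mid b -> (val a).2 = (val b).2 -> a = b.
Proof.
move=> h1 h2 h3; apply: val_inj; move: h1 h2 h3; rewrite /karoubi_mid.
by case: (val a) (val b) => [[? ?] ?] [[? ?] ?] /= -> -> ->.
Qed.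

Lemma karoubi_mulel a : (val a).1.1 * karoubi_mid a = karoubi_mid a.
Proof.
case: (set_valP a); rewrite /karoubi_mid /idempotents /= => ee _ s.
by rewrite s !mulgA ee.
Qed.

Lemma karoubi_muler a : karoubi_mid a * (val a).2 = karoubi_mid a.
Proof.
case: (set_valP a); rewrite /karoubi_mid /idempotents /= => _ ff s.
by rewrite s -!mulgA ff.
Qed.

Lemma karoubi_val_continuous : continuous (fun a => val a : S * S * S).
Proof. exact: set_val_continuous. Qed.

Lemma triple1_continuous : continuous (fun t : S * S * S => t.1.1).
Proof.
exact: (continuous_compo (@continuous_fst _ _) (@continuous_fst _ _)).
Qed.

Lemma triple2_continuous : continuous (fun t : S * S * S => t.1.2).
Proof.
exact: (continuous_compo (@continuous_fst _ _) (@continuous_snd _ _)).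
Qed.

Lemma triple3_continuous : continuous (fun t : S * S * S => t.2).
Proof. exact: continuous_snd. Qed.

Lemma karoubi_cod_continuous : continuous (fun a => (val a).1.1).
Proof. exact: (continuous_compo karoubi_val_continuous triple1_continuous). Qed.

Lemma karoubi_mid_continuous : continuous karoubi_mid.
Proof. exact: (continuous_compo karoubi_val_continuous triple2_continuous). Qed.

Lemma karoubi_dom_continuous : continuous (fun a => (val a).2).
Proof. exact: (continuous_compo karoubi_val_continuous triple3_continuous). Qed.

Lemma mul_continuous (T : topologicalType) (f g : T -> S) :
  continuous f -> continuous g -> continuous (fun x => f x * g x).
Proof.
move=> cf cg.
exact: (continuous_compo (continuous_pair cf cg) (@continuous_mulg S)).
Qed.

Lemma idempotents_closed : closed idempotents.
Proof.
by apply: closed_equalizer; [exact: hausdorff_semigroup|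
  apply: mul_continuous => x; exact: cvg_id | move=> x; exact: cvg_id].
Qed.

Lemma karoubi_arrows_closed : closed karoubi_arrows.
Proof.
rewrite (_ : karoubi_arrows = (fun t => t.1.1) @^-1` idempotents `&`
  ((fun t => t.2) @^-1` idempotents `&`
   [set t | t.1.2 = t.1.1 * t.1.2 * t.2])); last first.
  by apply/seteqP; split => t /= => [[]|[? []]].
apply: closedI; last apply: closedI.
- apply: preimage_closed idempotents_closed => t _.
  exact: triple1_continuous.
- apply: preimage_closed idempotents_closed => t _.
  exact: triple3_continuous.
- apply: closed_equalizer triple2_continuous _.
    exact: hausdorff_semigroup.
  apply: mul_continuous triple3_continuous.
  exact: mul_continuous triple1_continuous triple2_continuous.
Qed.

Program Definition karoubi : compactCategory :=
  @CompactCategory karoubi_obj karoubi_arr karoubi_dom karoubi_cod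
    karoubi_idn karoubi_compose _ _ _ _ _ _ _ _ _ _ _ _ _ _ _.
Next Obligation. by move=> *; exact: val_inj. Qed.
Next Obligation. by move=> *; exact: val_inj. Qed.
Next Obligation. by move=> *; exact: val_inj. Qed.
Next Obligation. by move=> *; exact: val_inj. Qed.
Next Obligation.
move=> x a h; have e : val x = (val a).1.1 := congr1 val h.
apply: karoubi_arr_eq => //=.
by rewrite -[RHS]karoubi_mulel -e.
Qed.
Next Obligation.
move=> x a h; have e : (val a).2 = val x := congr1 val h.
apply: karoubi_arr_eq => //=.
by rewrite -[RHS]karoubi_muler e.
Qed.
Next Obligation. by move=> *; apply: karoubi_arr_eq => //=; exact: mulgA. Qed.
Next Obligation.
apply: compact_set_type.
exact: (subclosed_compact idempotents_closed (@compact_semigroup S)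
          (@subsetT _ _)).
Qed.
Next Obligation. by apply: hausdorff_set_type; exact: hausdorff_semigroup. Qed.
Next Obligation.
apply: compact_set_type.
apply: (subclosed_compact karoubi_arrows_closed _ (@subsetT _ _)).
by do 2?apply: compact_setTX; exact: compact_semigroup.
Qed.
Next Obligation.
apply: hausdorff_set_type.
by do 2?apply: hausdorff_setX; exact: hausdorff_semigroup.
Qed.
Next Obligation.
by apply: continuous_to_set_type; exact: karoubi_dom_continuous.
Qed.
Next Obligation.
by apply: continuous_to_set_type; exact: karoubi_cod_continuous.
Qed.
Next Obligation.
have cv := @set_val_continuous S idempotents.
apply: continuous_to_set_type.
exact: (continuous_pair (continuous_pair cv cv) cv).
Qed.
Next Obligation.
apply: continuous_to_set_type.
set E := [set p | _].
have cp1 : continuous (fun p : E => (val p).1).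
  apply: (@continuous_compo _ _ _ (@set_val _ E) fst).
    exact: set_val_continuous.
  exact: continuous_fst.
have cp2 : continuous (fun p : E => (val p).2).
  apply: (@continuous_compo _ _ _ (@set_val _ E) snd).
    exact: set_val_continuous.
  exact: continuous_snd.
apply: continuous_pair; [apply: continuous_pair|].
- exact: (continuous_compo cp1 karoubi_cod_continuous).
- apply: mul_continuous.
    exact: (continuous_compo cp1 karoubi_mid_continuous).
  exact: (continuous_compo cp2 karoubi_mid_continuous).
- exact: (continuous_compo cp2 karoubi_dom_continuous).
Qed.
End Karoubi.

(** * Subshifts *)

Definition full_shift (A : finType) : topologicalType :=
  {ptws int -> discrete_topology A}.

Definition shift_map (A : finType) (x : full_shift A) : full_shift A :=
  fun i : int => x (i + 1)%R.

(* Nonemptiness of the subshift entails that of the alphabet. *)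
Record subshift (A : finType) := Subshift {
  subshift_set :> set (full_shift A);
  subshift_nonempty : subshift_set !=set0;
  subshift_closed : closed subshift_set;
  subshift_shift : @shift_map A @` subshift_set = subshift_set
}.

Definition conjugate (A B : finType) (X : subshift A) (Y : subshift B) : Prop :=
  exists (f : X -> Y) (g : Y -> X),
    [/\ continuous f, continuous g, cancel f g, cancel g f &
        forall x x' : X, val x' = shift_map (val x) ->
          val (f x') = shift_map (val (f x))].

Definition language (A : finType) (X : subshift A) : set (word A) :=
  [set w | exists (x : full_shift A) (i : int),
     subshift_set X x /\
     val w = mkseq (fun k : nat => x (i + k%:Z)%R) (size (val w))].

(** * Mirages *)

Definition is_factor (S : semigroupType) (w u : S) : Prop :=
  [\/ u = w, exists a, u = a * w, exists b, u = w * b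
    | exists a b, u = a * w * b].

(* Words are identified with their images in the free pro-V semigroup; the
   map free_proV_word is injective as soon as V contains LSl. *)
Definition mirage (V : finSemigroupType -> Prop) (A : finType)
    (X : subshift A) : set (free_proV V A) :=
  [set u | forall w : word A, is_factor (free_proV_word V w) u -> language X w].

Arguments mirage V {A} X.

Definition mirage_obj (V : finSemigroupType -> Prop) (A : finType)
    (X : subshift A) : set (obj (karoubi (free_proV V A))) :=
  [set e | mirage V X (val e)].

Definition mirage_arr (V : finSemigroupType -> Prop) (A : finType)
    (X : subshift A) : set (arr (karoubi (free_proV V A))) :=
  [set a | mirage V X (karoubi_mid a)].

Arguments mirage_obj V {A} X.
Arguments mirage_arr V {A} X.

(* Main.v *)
Require Import Defs.
From HB Require Import structures.
From mathcomp Require Import all_boot all_order all_algebra.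
From mathcomp Require Import generic_quotient.
From mathcomp Require Import all_classical all_reals all_analysis.
From mathcomp Require Import zify.

(* Idea.  Conjugacies are given by block codes phi and psi of some common
   radius m.  If e, f are idempotents and u = e u f, then every letter of u has
   a bi-infinite context: e on its left and f on its right.  Applying phi to u
   in that context gives (e, u, f) |-> (Phi(e,e,e), Phi(e,u,f), Phi(f,f,f)),
   and this is functorial, because u f = u and f v = v say that v looks like f
   from u, and u like f from v.  Since psi after phi is the identity on L(X),
   and the pseudowords of the mirage only have factors in L(X), the functors of
   phi and psi are inverse to each other.

   The hypothesis V = V * D makes Phi well defined, i.e. makes block codes
   uniformly continuous.  A code that only looks to the left is a transducer
   whose state is a suffix of bounded length, so composing it with a morphism
   into S in V gives a morphism into a semidirect product of a power of S by a
   semigroup of D.  To look to the right, the output is delayed by m letters;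
   the output of the first letters is replaced by arbitrary guessed values, and
   one of the guesses is right because every long product in a finite semigroup
   is also a product with m more factors.

   Finally LSl contained in V provides the quotients of A^+ that record the
   prefix, the suffix and the factors of some length. *)

Set Implicit Arguments.
Unset Strict Implicit.
Unset Printing Implicit Defensive.

Local Open Scope classical_set_scope.
Local Open Scope quotient_scope.
Local Open Scope group_scope.

(** * Products of sequences in a semigroup *)

Definition with_one (S : Type) : Type := option S.

Section WithOne.
Variable S : semigroupType.

(** A new unit [None] is adjoined even if [S] has a unit already. It gives a value to the empty
    product, so that big operators apply. *)
Definition with_one_mul (x y : with_one S) : with_one S :=
  match x, y with
  | Some a, Some b => Some (a * b)
  | None, _ => y
  | _, None => x
  end.

Lemma with_one_mulA : associative with_one_mul.
Proof. by move=> [x|] [y|] [z|] //=; rewrite mulgA. Qed.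

Lemma with_one_mul1 : left_id None with_one_mul.
Proof. by case. Qed.

Lemma with_one_mulr1 : right_id None with_one_mul.
Proof. by case. Qed.

HB.instance Definition _ := Choice.copy (with_one S) (option S).
HB.instance Definition _ :=
  isMonoid.Build (with_one S) with_one_mulA with_one_mul1 with_one_mulr1.

Definition some1 (x : S) : with_one S := Some x.

Lemma some1M x y : some1 (x * y) = some1 x * some1 y.
Proof. by []. Qed.

Lemma some1_inj : injective some1.
Proof. by move=> x y []. Qed.
End WithOne.

Lemma prod_some1_cons (S : semigroupType) (x : S) (s : seq S) :
  exists z, some1 z = \prod_(y <- x :: s) some1 y.
Proof.
elim: s x => [|y s IH] x; first by exists x; rewrite big_seq1.
by have [z hz] := IH y; exists (x * z); rewrite some1M hz [RHS]big_cons.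
Qed.

(* Two prefix products coincide, so the product between them may be
   repeated at will. *)
Lemma prod_pump (S : finSemigroupType) (n : nat) (s : seq S) :
  (#|S| < size s)%N ->
  exists2 t : seq S, size t = (size s + n)%N &
    \prod_(x <- t) some1 x = \prod_(x <- s) some1 x.
Proof.
move=> szs; pose p i : with_one S := \prod_(x <- take i s) some1 x.
(* Only nonempty prefixes are used: their products lie in [S], and there are [#|S|.+1] of them, so
   two coincide. *)
have hp (i : 'I_#|S|.+1) : exists z, some1 z = p i.+1.
  by rewrite /p; case: s szs {p} => // x s _; exact: prod_some1_cons.
pose q i := projT1 (cid (hp i)).
have hq i : some1 (q i) = p i.+1 := projT2 (cid (hp i)).
have /injectivePn[i [j ij qij]] : ~~ injectiveb q.
  by apply/negP => /injectiveP /leq_card; rewrite card_ord ltnn.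
wlog lij : i j ij qij / (i < j)%N.
  move=> H; case: (ltngtP i j) => [l|l|/val_inj e]; [exact: (H i j)| |].
    by apply: (H j i) => //; rewrite eq_sym.
  by rewrite e eqxx in ij.
set s1 := take i.+1 s; set s2 := drop i.+1 (take j.+1 s).
have e2 : take j.+1 s = s1 ++ s2.
  by rewrite -(cat_take_drop i.+1 (take j.+1 s)) take_takel // ltnW.
have sz2 : (0 < size s2)%N.
  by rewrite size_drop size_takel ?subn_gt0 ?ltnS // (leq_trans _ szs).
have [z hz] : exists z, some1 z = \prod_(x <- s2) some1 x.
  case: (s2) sz2 => // x s' _; exact: prod_some1_cons.
have pz : \prod_(x <- s1) some1 x * some1 z = \prod_(x <- s1) some1 x.
  have := hq j; rewrite -qij hq /p e2 big_cat /= => h.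
  by rewrite hz; exact/esym.
(* The factor [z] is the value of [s2], and [s1] absorbs it on the right, so [n] more copies leave
   the product unchanged. *)
exists (s1 ++ nseq n z ++ drop i.+1 s).
  have := congr1 size (cat_take_drop i.+1 s).
  by rewrite !size_cat size_nseq => <-; rewrite -addnA (addnC n).
rewrite -[s in RHS](cat_take_drop i.+1 s) !big_cat /= mulgA; congr (_ * _).
by elim: n => [|n IH]; rewrite ?big_nil ?mulg1 // big_cons mulgA pz.
Qed.

(** * Finite images and finite quotients *)

Section FiniteImage.
Variables (M : semigroupType) (T : finType) (h : M -> T).
Hypothesis hM : forall x x' y y' : M,
  h x = h x' -> h y = h y' -> h (x * y) = h (x' * y').

(* The proof [hM] is kept as a parameter so that the product of [fimage] can be
   inferred from its type. *)
Definition fimage : Type :=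
  let _ := hM in {t : T | `[< exists w, h w = t >]}.
HB.instance Definition _ := Finite.on fimage.
HB.instance Definition _ := SubType.on fimage.

Definition to_fimage (w : M) : fimage := exist _ (h w) (asboolT (ex_intro _ w erefl)).

Definition of_fimage (t : fimage) : M := projT1 (cid (asboolW (svalP t))).

Lemma of_fimageK t : to_fimage (of_fimage t) = t.
Proof. by apply: val_inj; exact: (projT2 (cid (asboolW (svalP t)))). Qed.

Definition fimage_mul (s t : fimage) : fimage :=
  to_fimage (of_fimage s * of_fimage t).

Lemma to_fimageM x y : to_fimage (x * y) = fimage_mul (to_fimage x) (to_fimage y).
Proof.
by apply: val_inj; apply: hM; apply/esym;
  exact: (congr1 val (of_fimageK (to_fimage _))).
Qed.

Lemma fimage_mulA : associative fimage_mul.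
Proof.
move=> x y z; rewrite -[x]of_fimageK -[y]of_fimageK -[z]of_fimageK.
by rewrite -!to_fimageM mulgA.
Qed.

HB.instance Definition _ := isSemigroup.Build fimage fimage_mulA.

Lemma fimageM x y : to_fimage x * to_fimage y = to_fimage (x * y).
Proof. by rewrite to_fimageM. Qed.

Lemma fimage_ind (P : fimage -> Prop) : (forall w, P (to_fimage w)) -> forall t, P t.
Proof. by move=> H t; rewrite -[t]of_fimageK. Qed.

Definition ker_rel : rel M := fun x y => h x == h y.

Lemma ker_refl : reflexive ker_rel. Proof. by move=> x; exact: eqxx. Qed.
Lemma ker_sym : symmetric ker_rel. Proof. by move=> x y; exact: eq_sym. Qed.
Lemma ker_trans : transitive ker_rel.
Proof. by move=> y x z /eqP e1 /eqP e2; rewrite /ker_rel e1 e2. Qed.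

Definition ker_cong : congruence M :=
  @Congruence M (EquivRel ker_rel ker_refl ker_sym ker_trans)
    (fun u u' v v' e e' => introT eqP (hM (eqP e) (eqP e'))).

Definition quot_fimage (x : quot ker_cong) : fimage := to_fimage (repr x).

Lemma quot_fimage_pi w : quot_fimage (\pi_(quot ker_cong) w) = to_fimage w.
Proof.
apply: val_inj => /=; apply/eqP.
have : \pi_(quot ker_cong) (repr (\pi_(quot ker_cong) w)) = \pi_(quot ker_cong) w.
  by rewrite reprK.
by move=> /eqmodP.
Qed.

Lemma quot_fimageM : {morph quot_fimage : x y / x * y}.
Proof.
move=> x y; rewrite -[x]reprK -[y]reprK.
rewrite -[X in quot_fimage X]quot_pi_mul !quot_fimage_pi.
exact: to_fimageM.
Qed.

HB.instance Definition _ := isMultiplicative.Build _ _ quot_fimage quot_fimageM.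

Lemma quot_fimage_bij : bijective quot_fimage.
Proof.
exists (fun t => \pi_(quot ker_cong) (of_fimage t)) => [x|t].
  rewrite -[x]reprK quot_fimage_pi; apply/eqmodP; apply/eqP.
  exact: (congr1 val (of_fimageK (to_fimage _))).
by rewrite quot_fimage_pi of_fimageK.
Qed.

(** The quotient of [M] by the kernel of [h] is isomorphic to [fimage]. Only the kernel has to be a
    congruence: [h] may take values in a bare finite type, as [test] does below. *)
Lemma vquot_fimage (V : finSemigroupType -> Prop) : V fimage ->
  exists th : vquot V M, forall x y, th x y = (h x == h y).
Proof.
move=> VS; have P : exists2 S : finSemigroupType, V S &
    exists f : {multiplicative quot ker_cong -> S}, bijective f.
  by exists fimage => //; exists quot_fimage; exact: quot_fimage_bij.
by exists (VQuot P).
Qed.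
End FiniteImage.

Section Quotients.
Variable V : finSemigroupType -> Prop.
Hypothesis hV : pseudovariety V.
Variable M : semigroupType.

(** The image of [h] is a subsemigroup of [S], hence belongs to [V]. *)
Lemma vquot_morph (S : finSemigroupType) (h : M -> S) :
  {morph h : x y / x * y} -> V S ->
  exists th : vquot V M, forall x y, th x y = (h x == h y).
Proof.
move=> hM VS.
have hC x x' y y' : h x = h x' -> h y = h y' -> h (x * y) = h (x' * y').
  by rewrite !hM => -> ->.
apply: (@vquot_fimage M S h hC).
have vM : {morph (val : fimage hC -> S) : x y / x * y}.
  move=> x y; elim/fimage_ind: x => x; elim/fimage_ind: y => y.
  by rewrite -[X in val X]to_fimageM /= hM.
pose vm := isMultiplicative.Build _ _ (val : fimage hC -> S) vM.
pose f : {multiplicative fimage hC -> S} := HB.pack (val : fimage hC -> S) vm.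
exact: (pseudovariety_sub hV (f := f) val_inj VS).
Qed.

Lemma vquot_hom (th : vquot V M) : exists (S : finSemigroupType) (h : M -> S),
  [/\ V S, {morph h : x y / x * y} & forall x y, th x y = (h x == h y)].
Proof.
have [S VS [f bf]] := vquotP th.
exists S, (fun w => f (\pi_(quot th) w)); split => //.
  by move=> x y; rewrite -gmulfM; congr (f _); exact: quot_pi_mul.
move=> x y; rewrite (inj_eq (bij_inj bf)).
by apply/idP/eqP => [e|/eqmodP //]; apply/eqmodP.
Qed.

(** The quotients are directed: the pair of the two quotient maps is a morphism into a direct
    product of members of [V]. *)
Lemma vquot_meet (th1 th2 : vquot V M) : exists th : vquot V M,
  forall x y, th x y -> th1 x y /\ th2 x y.
Proof.
have [S1 [h1 [V1 m1 e1]]] := vquot_hom th1.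
have [S2 [h2 [V2 m2 e2]]] := vquot_hom th2.
have [|th e] := @vquot_morph (S1 * S2)%type (fun w => (h1 w, h2 w)) _
  (pseudovariety_prod hV V1 V2).
  by move=> x y; rewrite m1 m2.
exists th => x y; rewrite e => /eqP[a b]; by rewrite e1 e2 a b !eqxx.
Qed.
End Quotients.

HB.instance Definition _ (I : finType) (S : finSemigroupType) :=
  Semigroup.on {ffun I -> S}.

(** Induction on the exponent, splitting off the first coordinate; the power with exponent 0 is the
    empty direct product. *)
Lemma pseudovariety_ffun (V : finSemigroupType -> Prop) (I : finType)
    (S : finSemigroupType) :
  pseudovariety V -> V S -> V {ffun I -> S}.
Proof.
move=> hV VS.
have P n : V {ffun 'I_n -> S}.
  elim: n => [|n IH].
    by apply: (pseudovariety_triv hV); rewrite card_ffun card_ord expn0.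
  pose f (u : {ffun 'I_n.+1 -> S}) : (S * {ffun 'I_n -> S})%type :=
    (u ord0, [ffun i => u (lift ord0 i)]).
  have fM : {morph f : x y / x * y}.
    by move=> x y; congr (_, _); [rewrite ffunE|apply/ffunP => i; rewrite !ffunE].
  pose F : {multiplicative {ffun 'I_n.+1 -> S} -> (S * {ffun 'I_n -> S})%type} :=
    HB.pack f (isMultiplicative.Build _ _ f fM).
  apply: (pseudovariety_sub hV (f := F)); last exact: (pseudovariety_prod hV VS IH).
  move=> x y [e0 /ffunP e]; apply/ffunP => i.
  by case: (unliftP ord0 i) => [j ->|-> //]; have := e j; rewrite !ffunE.
pose f (u : {ffun I -> S}) : {ffun 'I_#|I| -> S} := [ffun i => u (enum_val i)].
have fM : {morph f : x y / x * y}.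
  by move=> x y; apply/ffunP => i; rewrite !ffunE.
pose F : {multiplicative {ffun I -> S} -> {ffun 'I_#|I| -> S}} :=
  HB.pack f (isMultiplicative.Build _ _ f fM).
apply: (pseudovariety_sub hV (f := F)); last exact: P.
move=> x y /ffunP e; apply/ffunP => i.
by have := e (enum_rank i); rewrite !ffunE enum_rankK.
Qed.

(** * Locally testable congruences *)

(** Levi's lemma for the free monoid. *)
Lemma cat_eq_cat (T : Type) (x y p z : seq T) : x ++ y = p ++ z ->
  (exists2 t, x = p ++ t & z = t ++ y) \/ (exists2 t, p = x ++ t & y = t ++ z).
Proof.
elim: x p => [|a x IH] [|b p] //=.
- by move=> e; left; exists [::].
- by move=> e; right; exists (b :: p).
- by move=> e; left; exists (a :: x).
- move=> [-> /IH [[t -> ->]|[t -> ->]]]; [left|right]; by exists t.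
Qed.

Lemma take_catl (T : Type) n (s t : seq T) : (n <= size s)%N ->
  take n (s ++ t) = take n s.
Proof. by move=> h; rewrite takel_cat. Qed.

Lemma take_cat_take (T : Type) n (s t : seq T) :
  take n (take n s ++ t) = take n (s ++ t).
Proof.
have [h|h] := leqP n (size s); last by rewrite (take_oversize (ltnW h)).
by rewrite !take_catl ?size_takel // take_takel.
Qed.

Lemma take_cat_taker (T : Type) n (s t : seq T) :
  take n (s ++ take n t) = take n (s ++ t).
Proof.
rewrite !take_cat; case: ltnP => // h; congr (_ ++ _).
by rewrite take_takel // leq_subr.
Qed.

(** If [s] had fewer than [n] letters, doubling it would lengthen its truncation. This is how
    idempotents are seen to be long. *)
Lemma take_idem_size (T : Type) n (s : seq T) : (0 < size s)%N ->
  take n (s ++ s) = take n s -> (n <= size s)%N.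
Proof.
move=> s0 /(congr1 size); rewrite !size_take_min size_cat => e; lia.
Qed.

Section LocallyTestable.
Variable A : finType.
Implicit Types v w x y : seq A.

(** An occurrence of [v] meeting both [x] and [z] would contain [y] and further letters, hence be
    longer than [y]. *)
Lemma infix_cat3 v x y z : (size v <= size y)%N ->
  infix v (x ++ y ++ z) -> infix v (x ++ y) \/ infix v (y ++ z).
Proof.
move=> sz /infixP[p [s e]].
have [[t e1 e2]|[t e1 e2]] := cat_eq_cat e; last first.
  by right; apply/infixP; exists t, s.
left; have [[t' e3 e4]|[t' e3 e4]] := cat_eq_cat (etrans e2 (catA _ _ _)).
  have st : (size v = size t + size y + size t')%N by rewrite e3 !size_cat.
  have t'0 : t' = [::] by apply: size0nil; lia.
  have t0 : t = [::] by apply: size0nil; lia.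
  by rewrite e3 t'0 t0 cats0 /=; exact: suffix_infix _ _.
by apply/infixP; exists p, t'; rewrite e1 -catA e3.
Qed.

(** The congruence of locally testable languages, with prefixes and suffixes of length [N] instead
    of the usual [N - 1]. A word shorter than [N] is alone in its class. *)
Definition testably_equal N x y :=
  [/\ take N x = take N y, take N (rev x) = take N (rev y) &
      forall v, (size v <= N)%N -> infix v x = infix v y].

Lemma testably_equal_sym N x y : testably_equal N x y -> testably_equal N y x.
Proof. by move=> [a b c]; split=> // v /c. Qed.

(** A short factor of [x ++ y] lies in [x], lies in [y], or straddles the cut. In the last case it
    is a short suffix of [x] followed by a short prefix of [y]. *)
Lemma testably_equal_cat N x x' y y' : testably_equal N x x' ->
  testably_equal N y y' -> testably_equal N (x ++ y) (x' ++ y').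
Proof.
move=> Hx Hy; have [px sx fx] := Hx; have [py sy fy] := Hy; split.
- by rewrite -take_cat_take -take_cat_taker px py take_cat_taker take_cat_take.
- rewrite !rev_cat.
  by rewrite -take_cat_take -take_cat_taker sx sy take_cat_taker take_cat_take.
have H x1 x2 y1 y2 v : testably_equal N x1 x2 -> testably_equal N y1 y2 ->
    (size v <= N)%N -> infix v (x1 ++ y1) -> infix v (x2 ++ y2).
  move=> [_ sx' fx'] [py' _ fy'] sv /infixP[p [s e]].
  have [[t e1 e2]|[t e1 e2]] := cat_eq_cat e; last first.
    have : infix v y1 by apply/infixP; exists t, s.
    by rewrite fy' // => /infixP[q [r ->]]; apply/infixP; exists (x2 ++ q), r; rewrite -!catA.
  have [[t' e3 e4]|[t' e3 e4]] := cat_eq_cat e2; last first.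
    have : infix v x1 by apply/infixP; exists p, t'; rewrite e1 e3.
    by rewrite fx' // => /infixP[q [r ->]]; apply/infixP; exists q, (r ++ y2); rewrite -!catA.
  have sv' : (size v = size t + size t')%N by rewrite e3 size_cat.
  have lt : (size t <= N)%N by lia.
  have lt' : (size t' <= N)%N by lia.
  have [q eq] : exists q, x2 = q ++ t.
    exists (rev (drop (size t) (rev x2))); apply: (can_inj revK).
    rewrite rev_cat revK -[LHS](cat_take_drop (size t)); congr (_ ++ _).
    rewrite -(take_takel _ lt) -sx' e1 rev_cat take_takel //.
    by rewrite take_size_cat // size_rev.
  have [r er] : exists r, y2 = t' ++ r.
    exists (drop (size t') y2); rewrite -[LHS](cat_take_drop (size t')); congr (_ ++ _).
    by rewrite -(take_takel _ lt') -py' e4 take_takel // take_size_cat.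
  by apply/infixP; exists q, r; rewrite eq er e3 -!catA.
move=> v sv; apply/idP/idP; apply: H => //; exact: testably_equal_sym.
Qed.

Lemma testably_equal_short N x y : testably_equal N x y -> (size x < N)%N -> x = y.
Proof.
move=> [e _ _] sx; have := congr1 size e; rewrite !size_take_min => sz.
by move: e; rewrite take_oversize ?take_oversize //; lia.
Qed.

Lemma testably_equal_size N x y : testably_equal N x y ->
  (size x < N)%N = (size y < N)%N.
Proof.
by move=> [/(congr1 size) e _ _]; move: e; rewrite !size_take_min; lia.
Qed.

Lemma testably_equalS N K x y : (K <= N)%N ->
  testably_equal N x y -> testably_equal K x y.
Proof.
move=> KN [a b c]; split.
- by rewrite -(take_takel _ KN) a take_takel.
- by rewrite -(take_takel _ KN) b take_takel.
- by move=> v sv; apply: c; exact: leq_trans KN.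
Qed.

Definition trunc N x : N.-bseq A := insub_bseq N (take N x).

Lemma val_trunc N x : val (trunc N x) = take N x.
Proof. by rewrite /trunc val_insubd size_take_min geq_minl. Qed.

Definition test N (w : word A) : N.-bseq A * N.-bseq A * {set N.-bseq A} :=
  (trunc N (val w), trunc N (rev (val w)),
   [set v : N.-bseq A | infix (val v) (val w)]%SET).

Lemma testP N (x y : word A) :
  test N x = test N y <-> testably_equal N (val x) (val y).
Proof.
split=> [[/(congr1 val) a /(congr1 val) b /setP c]|[a b c]].
  rewrite !val_trunc in a b; split=> // v sv.
  by have := c (Bseq sv); rewrite !inE.
congr (_, _, _); first by apply: val_inj; rewrite !val_trunc.
  by apply: val_inj; rewrite !val_trunc.
by apply/setP => v; rewrite !inE c // size_bseq.
Qed.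

Lemma test_mul N (x x' y y' : word A) : test N x = test N x' ->
  test N y = test N y' -> test N (x * y) = test N (x' * y').
Proof. by move=> /testP a /testP b; apply/testP; exact: testably_equal_cat. Qed.

Lemma word_size (x : word A) : (0 < size (val x))%N.
Proof. by case: x => [[]]. Qed.

(** If [w] is idempotent modulo [test N], it has at least [N] letters, so it fixes the prefix and
    suffix of every [w x w]. The short factors of [(w x w)(w y w)] are those of [w x w] together
    with those of [w y w], and union is commutative and idempotent. *)
Lemma LSl_test N : LSl (fimage (@test_mul N)).
Proof.
have key (w x y : word A) (v : seq A) : testably_equal N (val (w * w)) (val w) ->
    (size v <= N)%N ->
    infix v (val ((w * x * w) * (w * y * w))) =
    infix v (val (w * x * w)) || infix v (val (w * y * w)).
  move=> Hw sv; have sw : (N <= size (val w))%N.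
    by have [e _ _] := Hw; apply: take_idem_size e; exact: word_size.
  have sub2 (a : word A) : infix v (val w) -> infix v (val (w * a * w)).
    by move=> h; apply: infix_trans h _; exact: suffix_infix _ _.
  apply/idP/orP => [|[]] h; last first.
  - by apply: infix_trans h _; exact: suffix_infix _ _.
  - by apply: infix_trans h _; exact: prefix_infix _ _.
  (* The middle [w] is at least as long as [v], so [v] lies in [w x w] or in [w w y w]. In the
     second case it lies in [w y w] or in [w w], whose short factors are those of [w]. *)
  have {h} : infix v (val (w * x) ++ val w ++ val (w * y * w)).
    by move: h; rewrite /= -!catA.
  move=> /(infix_cat3 (leq_trans sv sw))[h|]; first by left.
  have E : val (w * y * w) = val w ++ val (y * w) by rewrite /= -catA.
  rewrite E.
  move=> /(infix_cat3 (x := val w) (leq_trans sv sw))[h|h]; last by right.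
  by right; rewrite -E; apply: sub2; have [_ _ <-] := Hw.
move=> e; elim/fimage_ind: e => w ww.
have {}ww : testably_equal N (val (w * w)) (val w).
  by apply/testP; move: ww => /(congr1 val); rewrite -[X in val X]to_fimageM.
have sw : (N <= size (val w))%N.
  by have [e _ _] := ww; apply: take_idem_size e; exact: word_size.
have pre (x : seq A) : take N (val w ++ x) = take N (val w).
  by rewrite take_catl.
have suf (x : seq A) : take N (rev (x ++ val w)) = take N (rev (val w)).
  by rewrite rev_cat take_catl // size_rev.
have both (a b : word A) (u u' : seq A) : val a = val w ++ u -> val b = val w ++ u' ->
    (exists t, val a = t ++ val w) -> (exists t, val b = t ++ val w) ->
    (forall v, (size v <= N)%N -> infix v (val a) = infix v (val b)) ->
    test N a = test N b.
  move=> a1 b1 [t a2] [t' b2] H; apply/testP; split=> //.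
    by rewrite a1 b1 !pre.
  by rewrite a2 b2 !suf.
have M3 (u : word A) : to_fimage _ w * to_fimage _ u * to_fimage _ w =
    to_fimage (@test_mul N) (w * u * w).
  by rewrite (fimageM _ w u) (fimageM _ (w * u) w).
split=> [x y|x]; elim/fimage_ind: x => x; [elim/fimage_ind: y => y|];
  rewrite !M3.
- rewrite (fimageM _ (w * x * w) (w * y * w)) (fimageM _ (w * y * w) (w * x * w)).
  apply: val_inj => /=.
  apply: both; [by rewrite /= -!catA; reflexivity|by rewrite /= -!catA; reflexivity| | |].
  + by eexists; rewrite /= !catA; reflexivity.
  + by eexists; rewrite /= !catA; reflexivity.
  + by move=> v sv; rewrite !key // orbC.
- rewrite (fimageM _ (w * x * w) (w * x * w)); apply: val_inj => /=.
  apply: both; [by rewrite /= -!catA; reflexivity|by rewrite /= -!catA; reflexivity| | |].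
  + by eexists; rewrite /= !catA; reflexivity.
  + by eexists; reflexivity.
  + by move=> v sv; rewrite !key // orbb.
Qed.

Lemma vquot_test (V : finSemigroupType -> Prop) :
  (forall S : finSemigroupType, LSl S -> V S) -> forall N,
  exists th : vquot V (word A),
    forall x y : word A, th x y -> testably_equal N (val x) (val y).
Proof.
move=> hLSl N; have [th e] := vquot_fimage (hLSl _ (@LSl_test N)).
by exists th => x y; rewrite e => /eqP/testP.
Qed.
End LocallyTestable.

(** * Block codes *)

(* The left context [l] is stored in reverse order. *)
Fixpoint block_code (A B : Type) (phi : seq A -> A -> seq A -> B)
    (l y r : seq A) : seq B :=
  if y is a :: y' then phi l a (y' ++ r) :: block_code phi (a :: l) y' r else [::].

Definition local_rule (A B : Type) m (phi : seq A -> A -> seq A -> B) :=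
  forall l l' a r r', take m l = take m l' -> take m r = take m r' ->
    phi l a r = phi l' a r'.

Section Code.
Variables (A B : Type) (phi : seq A -> A -> seq A -> B).
Implicit Types l y r : seq A.

Lemma size_code l y r : size (block_code phi l y r) = size y.
Proof. by elim: y l => //= a y IH l; rewrite IH. Qed.

Lemma code_cat l y1 y2 r :
  block_code phi l (y1 ++ y2) r =
  block_code phi l y1 (y2 ++ r) ++ block_code phi (catrev y1 l) y2 r.
Proof. by elim: y1 l => //= a y1 IH l; rewrite IH catA. Qed.

Lemma take_cons_eq (T : Type) m (a : T) s t :
  take m s = take m t -> take m (a :: s) = take m (a :: t).
Proof.
by case: m => // m e; rewrite /= -(take_takel s (leqnSn m)) e take_takel.
Qed.

Lemma take_cat_eq (T : Type) m (x s t : seq T) :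
  take m s = take m t -> take m (x ++ s) = take m (x ++ t).
Proof. by move=> e; rewrite -take_cat_taker e take_cat_taker. Qed.

Lemma code_local m l l' y r r' : local_rule m phi ->
  take m l = take m l' -> take m r = take m r' ->
  block_code phi l y r = block_code phi l' y r'.
Proof.
move=> loc el er; elim: y l l' el => //= a y IH l l' el; congr (_ :: _).
  by apply: loc => //; exact: take_cat_eq.
by apply: IH; exact: take_cons_eq.
Qed.
End Code.

Lemma code_neq0 (A B : finType) (phi : seq A -> A -> seq A -> B) l (y : word A) r :
  block_code phi l (val y) r != [::].
Proof. by case: y => -[|a y] //. Qed.

Definition code_word (A B : finType) (phi : seq A -> A -> seq A -> B) l (y : word A) r
  : word B := exist _ (block_code phi l (val y) r) (code_neq0 phi l y r).

(** * Sequential transducers *)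

Section Suffixes.
Variables (A : finType) (K : nat).

(* Suffixes of length at most K.+1, read from right to left. *)
Definition suffixes : Type := {t : K.+1.-bseq A | (0 < size t)%N}.
HB.instance Definition _ := Finite.on suffixes.
HB.instance Definition _ := SubType.on suffixes.

Lemma suffixes_mul_subproof (s t : suffixes) :
  (0 < size (trunc K.+1 (val (val t) ++ val (val s))))%N.
Proof.
rewrite -[size _]/(size (val (trunc _ _))) val_trunc size_take_min size_cat.
by rewrite leq_min /= addn_gt0 (valP t).
Qed.

Definition suffixes_mul (s t : suffixes) : suffixes :=
  exist _ (trunc K.+1 (val (val t) ++ val (val s))) (suffixes_mul_subproof s t).

Lemma val_suffixes_mul s t :
  val (val (suffixes_mul s t)) = take K.+1 (val (val t) ++ val (val s)).
Proof. by rewrite val_trunc. Qed.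

Lemma suffixes_mulA : associative suffixes_mul.
Proof.
move=> x y z; apply: val_inj; apply: val_inj.
by rewrite !val_suffixes_mul take_cat_taker take_cat_take catA.
Qed.

HB.instance Definition _ := isSemigroup.Build suffixes suffixes_mulA.

(** An idempotent suffix has full length [K.+1], so nothing written before it is visible. *)
Lemma Dvar_suffixes : Dvar suffixes.
Proof.
move=> e /(congr1 (fun t => val (val t))); rewrite val_suffixes_mul => ee x.
apply: val_inj; apply: val_inj; rewrite val_suffixes_mul.
have se : (K.+1 <= size (val (val e)))%N.
  apply: take_idem_size; first exact: (valP e).
  by rewrite ee take_oversize // size_bseq.
by rewrite take_catl // take_oversize // size_bseq.
Qed.

Lemma suffix_of_subproof (y : word A) : (0 < size (trunc K.+1 (rev (val y))))%N.
Proof.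
rewrite -[size _]/(size (val (trunc _ _))) val_trunc size_take_min size_rev.
by rewrite leq_min /= word_size.
Qed.

Definition suffix_of (y : word A) : suffixes :=
  exist _ (trunc K.+1 (rev (val y))) (suffix_of_subproof y).

Lemma val_suffix_of y : val (val (suffix_of y)) = take K.+1 (rev (val y)).
Proof. by rewrite val_trunc. Qed.

Lemma suffix_ofM : {morph suffix_of : x y / x * y}.
Proof.
move=> x y; apply: val_inj; apply: val_inj; rewrite val_suffixes_mul.
by rewrite !val_suffix_of take_cat_taker take_cat_take /= rev_cat.
Qed.
End Suffixes.

Section Transducer.
Variables (A I : finType) (S : finSemigroupType) (K : nat).
Variable out : I -> seq A -> A -> S.
Hypothesis out_local : forall i p p' a,
  take K.+1 p = take K.+1 p' -> out i p a = out i p' a.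

(** Here [p] is the part already read, latest letter first. The index [i] ranges over a finite
    family of transducers, so that a single quotient can serve all of them. *)
Fixpoint run i (p y : seq A) : seq S :=
  if y is a :: y' then out i p a :: run i (a :: p) y' else [::].

Lemma run_cat i p y z : run i p (y ++ z) = run i p y ++ run i (catrev y p) z.
Proof. by elim: y p => //= a y IH p; rewrite IH. Qed.

Lemma run_local i p p' y : take K.+1 p = take K.+1 p' -> run i p y = run i p' y.
Proof.
elim: y p p' => //= a y IH p p' e; rewrite (out_local _ _ e); congr (_ :: _).
by apply: IH; exact: take_cons_eq.
Qed.

Lemma run_value_ex i p (y : word A) :
  exists z, some1 z = \prod_(x <- run i p (val y)) some1 x.
Proof. by case: y => -[|a y] //= _; exact: prod_some1_cons. Qed.

Definition run_value i p y : S := projT1 (cid (run_value_ex i p y)).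

Lemma run_valueE i p y :
  some1 (run_value i p y) = \prod_(x <- run i p (val y)) some1 x.
Proof. exact: (projT2 (cid (run_value_ex i p y))). Qed.

Let C := (K.+1.-bseq A * I)%type.
Let SC : finSemigroupType := {ffun C -> S}.

(** A coordinate is a state, namely the letters last read and the choice of a transducer. Reading
    [t] moves the state before [F] is evaluated, as in a wreath product. *)
Definition suffix_act_fun (t : suffixes A K) (F : SC) : SC :=
  [ffun c : C => F (trunc K.+1 (val (val t) ++ val c.1), c.2)].

Lemma suffix_actM t : {morph suffix_act_fun t : x y / x * y}.
Proof. by move=> x y; apply/ffunP => c; rewrite !ffunE. Qed.

Lemma suffix_actA t t' F :
  suffix_act_fun (t * t') F = suffix_act_fun t (suffix_act_fun t' F).
Proof.
apply/ffunP => c; rewrite !ffunE /=; congr (F (_, _)).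
apply: val_inj; rewrite !val_trunc.
by rewrite take_cat_take take_cat_taker catA.
Qed.

Definition suffix_act : left_action SC (suffixes A K) :=
  LeftAction suffix_actM suffix_actA.

Definition transduce (y : word A) : semidirect suffix_act :=
  ([ffun c : C => run_value c.2 (val c.1) y], suffix_of K y).

(** The output on [x y] is the output on [x] times the output on [y] from the state reached after
    [x]. That state is known from the suffix of [x] and the initial state. *)
Lemma transduceM : {morph transduce : x y / x * y}.
Proof.
move=> x y; congr (_, _); last exact: suffix_ofM.
apply/ffunP => -[l i]; rewrite !ffunE /=; apply: some1_inj.
rewrite some1M !run_valueE /= run_cat big_cat /=; congr (_ * _).
rewrite (@run_local _ _ (val (trunc K.+1 (val (trunc K.+1 (rev (val x))) ++ val l)))) //.
by rewrite !val_trunc take_takel // take_cat_take catrevE.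
Qed.

(** The semidirect product of a power of [S] by [suffixes] belongs to [V * D = V]. The kernel of
    [transduce] is thus one of the quotients, and the coordinates at the empty state give the
    outputs. *)
Lemma transducer_continuous (V : finSemigroupType -> Prop) :
  pseudovariety V -> (forall S, V S <-> semidirect_var V Dvar S) -> V S ->
  exists th : vquot V (word A), forall y y', th y y' -> forall i,
    \prod_(x <- run i [::] (val y)) some1 x = \prod_(x <- run i [::] (val y')) some1 x.
Proof.
move=> hV hVD VS.
have VU : V (semidirect suffix_act).
  apply/hVD => P _ H; apply: H; last exact: Dvar_suffixes.
  exact: pseudovariety_ffun.
have [th e] := vquot_morph hV transduceM VU.
exists th => y y'; rewrite e => /eqP[/ffunP h _] i.
by have := h ([bseq], i); rewrite !ffunE /= => h'; rewrite -!run_valueE h'.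
Qed.
End Transducer.

(** * Uniform continuity of block codes *)

Section CodeContinuous.
Variables (A B : finType) (phi : seq A -> A -> seq A -> B) (m : nat).
Hypothesis phi_local : local_rule m phi.

Definition letter (b : B) : word B := exist _ [:: b] isT.

Lemma prod_letters (S : finSemigroupType) (h : word B -> S) (w : word B) :
  {morph h : x y / x * y} ->
  some1 (h w) = \prod_(b <- val w) some1 (h (letter b)).
Proof.
move=> hM; case: w => -[|b s] // p; elim: s b p => [|c s IH] b p.
  by rewrite big_seq1; congr (some1 (h _)); exact: val_inj.
rewrite big_cons -[X in _ * X](IH c isT) -some1M -hM.
by congr (some1 (h _)); exact: val_inj.
Qed.

Variables (S : finSemigroupType) (h : word B -> S).
Hypothesis hM : {morph h : x y / x * y}.
(** The summand [#|S|.+1] lets the product of the first [L] outputs be pumped to [N] factors. The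
    summand [m] makes the first [L] letters a full left context for what follows. *)
Let L := (m + #|S|.+1)%N.
Let N := (L + m)%N.

(** The head of [q] is the letter just read. The letter coded is the one [m] places earlier, and the
    [m] letters read since then are its right context. *)
Definition delayed_rule (q : seq A) (a : A) : B :=
  phi (drop m.+1 q) (nth a q m) (rev (take m q)).

(* Reads its input with a delay of [m] letters, so that the right contexts
   of [phi] are known.  The output of the first [N] letters, which is not
   yet determined by what was read, is guessed by [tau]. *)
Definition guess_out (tau : N.-tuple S) (p : seq A) (a : A) : S :=
  nth (h (letter (delayed_rule (a :: p) a))) tau (size p).

(** A window of more than [N] letters shows whether the position is still in the guessed part, and
    which guess is due. After that part, only [2m + 1] letters are inspected, the current one
    included. *)
Lemma guess_out_local tau p p' a :
  take (N + m.*2).+1 p = take (N + m.*2).+1 p' ->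
  guess_out tau p a = guess_out tau p' a.
Proof.
move=> e; have := congr1 size e; rewrite !size_take_min => sz.
have [lt|ge] := ltnP (size p) N.
  have lt' : (size p' < N)%N by lia.
  by move: e; rewrite !take_oversize; [move=> -> | lia | lia].
have ge' : (N <= size p')%N by lia.
rewrite /guess_out !nth_default ?size_tuple //.
congr (h (letter _)); rewrite /delayed_rule.
have eT k : (k <= (N + m.*2).+2)%N -> take k (a :: p) = take k (a :: p').
  by case: k => // k; rewrite ltnS => lk; rewrite /= -(take_takel p lk) e take_takel.
have -> : nth a (a :: p) m = nth a (a :: p') m.
  have lm : (m < (N + m.*2).+2)%N by lia.
  by rewrite -(nth_take a lm) eT // nth_take.
apply: phi_local; last by rewrite eT //; lia.
by rewrite !take_drop eT // addnS; lia.
Qed.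

Lemma run_guess tau p y : (size p + size y <= N)%N ->
  run guess_out tau p y = take (size y) (drop (size p) tau).
Proof.
elim: y p => [|a y IH] p /= sz; first by rewrite take0.
rewrite IH /=; last by lia.
have sp : (size p < size tau)%N by rewrite size_tuple; lia.
by rewrite (drop_nth (h (letter (delayed_rule (a :: p) a))) sp).
Qed.

(** The last [m] letters of [p] are still waiting to be coded. The output is therefore the code of
    these letters followed by [y], without its last [m] letters; each coded letter has [m] known
    letters after it, so [r] is arbitrary. *)
Lemma run_delay tau p y r : (N <= size p)%N ->
  run guess_out tau p y = [seq h (letter b) | b <- take (size y)
    (block_code phi (drop m p) (rev (take m p) ++ y) r)].
Proof.
elim: y p => [|a y IH] p sp; first by rewrite take0.
rewrite [LHS]/= IH; last by rewrite /=; lia.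
set q := a :: p; have sq : (m < size q)%N by rewrite /= /L; move: sp; rewrite /N /L; lia.
have -> : rev (take m p) ++ a :: y = nth a q m :: rev (take m q) ++ y.
  rewrite -cat_rcons -rev_cons -[a :: take m p]/(take m.+1 q) (take_nth a sq).
  by rewrite rev_rcons.
rewrite -[drop m p]/(drop m.+1 q) [block_code _ _ (_ :: _) _]/= -(drop_nth a sq).
rewrite [RHS]/=; congr (_ :: _); rewrite /guess_out nth_default ?size_tuple //.
congr (h (letter _)); apply: phi_local => //.
by rewrite -catA [RHS]take_catl // size_rev size_takel // ltnW.
Qed.

(* The first part of the output is the one to be guessed, the second one is
   computed by the transducer, and the last one only depends on a suffix. *)
Lemma code_split l y r : (N <= size y)%N ->
  exists o c d d', [/\ y = o ++ c ++ drop N y, size o = L, size c = m,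
    c ++ drop N y = d ++ d' & size d' = m] /\
    block_code phi l y r = block_code phi l o c ++ block_code phi (rev o) d d' ++
      block_code phi (take m (drop m (rev y))) (rev (take m (rev y))) r.
Proof.
move=> sy; pose o := take L y; pose c := take m (drop L y).
have so : size o = L by rewrite size_takel //; rewrite /N in sy; lia.
have sc : size c = m by rewrite size_takel // size_drop; rewrite /N in sy; lia.
have ey : y = o ++ c ++ drop N y.
  rewrite -[LHS](cat_take_drop L) -/o -[drop L y](cat_take_drop m) -/c drop_drop.
  by rewrite addnC.
pose d := take (size y - N)%N (c ++ drop N y); pose d' := drop (size y - N)%N (c ++ drop N y).
have ed : c ++ drop N y = d ++ d' by rewrite cat_take_drop.
have sd' : size d' = m by rewrite size_drop size_cat size_drop sc; lia.
exists o, c, d, d'; split; first by split.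
have yd : rev y = rev d' ++ rev (o ++ d) by rewrite {1}ey ed catA rev_cat.
have -> : take m (rev y) = rev d' by rewrite yd take_size_cat // size_rev.
have -> : drop m (rev y) = rev (o ++ d) by rewrite yd drop_size_cat // size_rev.
rewrite revK [X in block_code phi l X r]ey code_cat ed code_cat; congr (_ ++ (_ ++ _)).
- by apply: (code_local _ phi_local) => //; rewrite -ed -catA take_catl ?sc.
- apply: (code_local _ phi_local); last by rewrite take_catl ?sd'.
  by rewrite catrevE take_catl // size_rev so leq_addr.
- apply: (code_local _ phi_local) => //; rewrite [RHS]take_takel //.
  rewrite !catrevE catA -rev_cat take_catl // size_rev size_cat so.
  by rewrite /L; lia.
Qed.

(** The first [L] outputs are determined by [l] and the first [N] letters, which [y] and [y'] share;
    hence one guess is right for both. The middle part is the output of the transducer, and the end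
    is determined by [r] and the last [2m] letters. *)
Lemma code_congruence y y' :
  testably_equal (N + m.*2) y y' ->
  (forall tau, \prod_(s <- run guess_out tau [::] y) some1 s =
               \prod_(s <- run guess_out tau [::] y') some1 s) ->
  forall l r, \prod_(b <- block_code phi l y r) some1 (h (letter b)) =
              \prod_(b <- block_code phi l y' r) some1 (h (letter b)).
Proof.
move=> Hy Hrun l r; have [sy|sy] := ltnP (size y) N.
  by rewrite (testably_equal_short Hy) // (leq_trans sy) ?leq_addr.
have sy' : (N <= size y')%N.
  have := testably_equal_size (testably_equalS (leq_addr m.*2 N) Hy).
  by rewrite !ltnNge sy /= => /esym/negbFE.
have [eN _ _] := testably_equalS (leq_addr m.*2 N) Hy.
have [_ em _] : testably_equal (m + m) y y'.
  by apply: testably_equalS Hy; rewrite addnn leq_addl.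
(* For a right guess [tau], the output of the transducer is the code of [z] deprived of its last [m]
   letters. *)
have splitE z : (N <= size z)%N -> forall tau : N.-tuple S,
    \prod_(s <- tau) some1 s =
    \prod_(b <- block_code phi l (take L z) (drop L (take N z)))
      some1 (h (letter b)) ->
    \prod_(b <- block_code phi l z r) some1 (h (letter b)) =
    \prod_(s <- run guess_out tau [::] z) some1 s *
    \prod_(b <- block_code phi (take m (drop m (rev z))) (rev (take m (rev z))) r)
      some1 (h (letter b)).
  move=> sz tau etau; have [ o [c [d [d' [[ez so sc ed sd'] ->]]]]] := code_split l r sz.
  rewrite !big_cat /= mulgA; congr (_ * _).
  have tL : take L z = o by rewrite ez take_size_cat.
  have tN : take N z = o ++ c by rewrite ez catA take_size_cat // size_cat so sc.
  rewrite tL tN drop_size_cat // in etau.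
  rewrite {1}ez catA run_cat big_cat /= run_guess ?size_cat ?so ?sc //.
  rewrite drop0 take_oversize ?size_tuple // etau; congr (_ * _).
  rewrite catrevE cats0 (@run_delay _ _ _ r); last by rewrite size_rev size_cat so sc.
  rewrite rev_cat drop_size_cat ?size_rev // take_size_cat ?size_rev // revK ed.
  rewrite code_cat take_size_cat ?big_map; last first.
    rewrite size_code; have := congr1 size ed; rewrite !size_cat sc sd'; lia.
  rewrite (@code_local _ _ phi m (rev o) (rev o) d d' (d' ++ r)) //.
  by rewrite take_catl ?sd'.
(* The [L] correct outputs number more than [#|S|]. They are pumped by [m] factors to fill the [N]
   places of the guess. *)
have [t st et] : exists2 t : seq S, size t = N & \prod_(s <- t) some1 s =
    \prod_(b <- block_code phi l (take L y) (drop L (take N y))) some1 (h (letter b)).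
  have [|t st et] := @prod_pump S m
    [seq h (letter b) | b <- block_code phi l (take L y) (drop L (take N y))].
    by rewrite size_map size_code size_takel /L ?(leq_trans _ sy) /N /L; lia.
  exists t; last by rewrite et big_map.
  by rewrite st size_map size_code size_takel // (leq_trans _ sy) // leq_addr.
pose tau : N.-tuple S := tcast st (in_tuple t).
have etau : \prod_(s <- tau) some1 s = \prod_(s <- t) some1 s by rewrite val_tcast.
rewrite (splitE y sy tau) ?etau // (splitE y' sy' tau) ?etau ?Hrun //; last first.
  have -> : take L y' = take L y.
    by rewrite -(take_takel _ (leq_addr m L)) -/N -eN take_takel // leq_addr.
  by rewrite -eN.
congr (_ * _); rewrite !take_drop em.
by rewrite -(take_takel (rev y) (leq_addr m m)) em take_takel // leq_addr.
Qed.
End CodeContinuous.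

Section CodeUniform.
Variables (V : finSemigroupType -> Prop) (A B : finType).
Hypothesis hV : pseudovariety V.
Hypothesis hLSl : forall S : finSemigroupType, LSl S -> V S.
Hypothesis hVD : forall S : finSemigroupType, V S <-> semidirect_var V Dvar S.

Lemma code_uniform (phi : seq A -> A -> seq A -> B) m : local_rule m phi ->
  forall th : vquot V (word B), exists th' : vquot V (word A),
    forall (y y' : word A), th' y y' ->
      forall l r, th (code_word phi l y r) (code_word phi l y' r).
Proof.
move=> loc th; have [S [h [VS hM eth]]] := vquot_hom th.
pose K := (m + #|S|.+1 + m + m.*2)%N.
have [th1 H1] := transducer_continuous (I := (m + #|S|.+1 + m).-tuple S)
  (guess_out_local loc h) hV hVD VS.
have [th2 H2] := vquot_test A hLSl K.
have [th' H] := vquot_meet hV th1 th2.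
exists th' => y y' /H[/H1 e1 /H2 e2] l r; rewrite eth; apply/eqP.
apply: some1_inj; rewrite !prod_letters //=.
apply: (code_congruence loc e2 e1).
Qed.
End CodeUniform.

(** * Approximating pseudowords by words *)

Section Approximation.
Variables (V : finSemigroupType -> Prop) (M : semigroupType).
Hypothesis hV : pseudovariety V.
Implicit Types (u v : completion V M) (th : vquot V M) (w : M).

Definition approximates th u w : Prop := val u th = \pi_(quot th) w.

Lemma approx_ex th u : exists w, approximates th u w.
Proof. by exists (repr (val u th)); rewrite /approximates reprK. Qed.

Lemma approx_eq th u w w' : approximates th u w -> approximates th u w' -> th w w'.
Proof. by rewrite /approximates => -> /eqmodP. Qed.

Lemma approx_sub th th' u w :
  (forall x y, th x y -> th' x y) -> approximates th u w -> approximates th' u w.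
Proof. by move=> s; exact: (@set_valP _ _ u th th' s w). Qed.

Lemma approxM th u v w w' : approximates th u w -> approximates th v w' ->
  approximates th (u * v) (w * w').
Proof.
rewrite /approximates quot_pi_mul => <- <-; reflexivity.
Qed.

Lemma approx_separated u v :
  (forall th, exists w, approximates th u w /\ approximates th v w) -> u = v.
Proof.
move=> H; apply: val_inj; apply: functional_extensionality_dep => th.
by have [w [a b]] := H th; rewrite a b.
Qed.

Lemma vquot_inhabited : inhabited (vquot V M).
Proof.
have hM x x' y y' (_ : tt = tt) (_ : tt = tt) :
  (fun _ : M => tt) (x * y) = (fun _ : M => tt) (x' * y') by [].
(* The empty power has exactly one element, even when [M] is empty. *)
pose S : finSemigroupType := {ffun 'I_0 -> fimage hM}.
have VS : V S by apply: (pseudovariety_triv hV); rewrite card_ffun card_ord expn0.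
have e (f g : S) : f = g by apply/ffunP => -[].
have [|th _] := @vquot_morph V hV M S (fun _ => ffun0 (card_ord 0)) _ VS.
  by move=> x y; exact: e.
exact: inhabits th.
Qed.

(** Since the quotients are directed, finitely many coordinates are controlled by one. The sets
    given by one coordinate form a filter base, and this filter converges to [u] in the product. *)
Lemma nbhs_approx u (U : set (completion V M)) : nbhs u U ->
  exists th, forall v, val v th = val u th -> U v.
Proof.
pose F : set_system (completion V M) :=
  filter_from [set: vquot V M] (fun th => [set v | val v th = val u th]).
have FF : Filter F.
  apply: filter_from_filter.
    by have [th] := vquot_inhabited; exists th.
  move=> th1 th2 _ _; have [th H] := vquot_meet hV th1 th2.
  exists th => // v /= e.
  have [w nw] := approx_ex th u; have nv : approximates th v w := etrans e nw.
  by split; apply: etrans (approx_sub _ nv) (esym (approx_sub _ nw)) => x y /H[].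
move=> uU; suff : F U by move=> [th _ H]; exists th => v e; exact: H.
have [_ [[W oW <-] Wu] WU] := uU.
have cF : (set_val @ F) --> (val u : vquot_prod V M).
  apply/cvg_sup => th O [_ [[P oP <-] /= Pu] PO].
  exists th => // v /= e; apply: PO => /=; move: Pu.
  by congr (P _); exact/esym.
exact: (@filterS _ F FF _ _ WU (cF W (open_nbhs_nbhs (conj oW Wu)))).
Qed.

Lemma closed_approx (C : set (completion V M)) u : closed C ->
  (forall th, exists2 v, C v & val v th = val u th) -> C u.
Proof.
move=> cC H; apply: cC => U /nbhs_approx[th HU].
by have [v Cv e] := H th; exists v; split => //; exact: HU.
Qed.

Lemma continuous_approx (T : topologicalType) (f : T -> completion V M) :
  (forall t th, nbhs t [set t' | val (f t') th = val (f t) th]) -> continuous f.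
Proof.
move=> H; apply: continuous_to_set_type; apply: vquot_prod_continuous => th t U.
move=> /nbhs_singleton Ut; apply: filterS (H t th) => t' e.
by move: Ut; congr (U _); exact/esym.
Qed.

Lemma nbhs_coord (T : topologicalType) (f : T -> completion V M) th t :
  continuous f -> nbhs t [set t' | val (f t') th = val (f t) th].
Proof.
pose pr (v : completion V M) : discrete_topology (quot th) := val v th.
have cpr : continuous pr.
  apply: (@continuous_compo _ _ _ set_val (fun u : vquot_prod V M => u th)).
    exact: set_val_continuous.
  exact: vquot_proj_continuous.
move=> cf; exact: (continuous_compo cf cpr (discrete_set1 (pr (f t)))).
Qed.
End Approximation.

(** * Mirages *)

Lemma is_factor_trans (S : semigroupType) (w v u : S) :
  is_factor w v -> is_factor v u -> is_factor w u.
Proof.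
move=> [->|[a ->]|[b ->]|[a [b ->]]] [->|[c ->]|[d ->]|[c [d ->]]].
- by constructor 1; rewrite ?mulgA.
- by constructor 2; exists c; rewrite ?mulgA.
- by constructor 3; exists d; rewrite ?mulgA.
- by constructor 4; exists c, d; rewrite ?mulgA.
- by constructor 2; exists a; rewrite ?mulgA.
- by constructor 2; exists (c * a); rewrite ?mulgA.
- by constructor 4; exists a, d; rewrite ?mulgA.
- by constructor 4; exists (c * a), d; rewrite ?mulgA.
- by constructor 3; exists b; rewrite ?mulgA.
- by constructor 4; exists c, b; rewrite ?mulgA.
- by constructor 3; exists (b * d); rewrite ?mulgA.
- by constructor 4; exists c, (b * d); rewrite ?mulgA.
- by constructor 4; exists a, b; rewrite ?mulgA.
- by constructor 4; exists (c * a), b; rewrite ?mulgA.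
- by constructor 4; exists a, (b * d); rewrite ?mulgA.
- by constructor 4; exists (c * a), (b * d); rewrite ?mulgA.
Qed.

(** A finite union of continuous images of compact spaces. *)
Lemma is_factor_closed (S : compactSemigroupType) (w : S) :
  closed [set u | is_factor w u].
Proof.
have cid : continuous (@id S) by move=> x; exact: cvg_id.
have cW (T : topologicalType) : continuous (fun _ : T => w) by move=> x; exact: cvg_cst.
have im (T : topologicalType) (f : T -> S) :
    compact [set: T] -> continuous f -> closed (range f).
  move=> cT cf; apply: compact_closed; first exact: hausdorff_semigroup.
  by apply: continuous_compact cT; exact: continuous_subspaceT.
rewrite (_ : [set u | _] = range (fun _ : S => w) `|` range (fun a => a * w) `|`
  range (fun b => w * b) `|` range (fun p : S * S => p.1 * w * p.2)); last first.
  apply/seteqP; split=> u /=.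
    move=> [->|[a ->]|[b ->]|[a [b ->]]].
    - by do 3?left; exists w.
    - by do 2?left; right; exists a.
    - by left; right; exists b.
    - by right; exists (a, b).
  move=> [[[[a _ <-]|[a _ <-]]|[b _ <-]]|[[a b] _ <-]].
  - by constructor 1.
  - by constructor 2; exists a.
  - by constructor 3; exists b.
  - by constructor 4; exists a, b.
have cS := @compact_semigroup S.
apply: closedU; first apply: closedU; first apply: closedU; apply: im => //.
- exact: (@Defs.mul_continuous _ _ id (fun=> w)).
- exact: (@Defs.mul_continuous _ _ (fun=> w) id).
- exact: compact_setTX.
- apply: Defs.mul_continuous; last exact: continuous_snd.
  by apply: Defs.mul_continuous => //; exact: continuous_fst.
Qed.

Section Mirage.
Variables (V : finSemigroupType -> Prop) (A : finType).
Hypothesis hV : pseudovariety V.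
Hypothesis hLSl : forall S : finSemigroupType, LSl S -> V S.
Implicit Types (th : vquot V (word A)) (u v e f : free_proV V A).

Definition refines_test N th :=
  forall x y : word A, th x y -> testably_equal N (val x) (val y).

Lemma approx_word th (w : word A) : approximates th (free_proV_word V w) w.
Proof. by []. Qed.

(** If [u = a w b], replacing [a] and [b] by approximating words gives a word that contains [w] and
    is [th]-equivalent to [x]; the other cases are similar. *)
Lemma factor_approx N th u (w x : word A) : refines_test N th ->
  is_factor (free_proV_word V w) u -> approximates th u x -> (size (val w) <= N)%N ->
  infix (val w) (val x).
Proof.
move=> Hth wu ux sw.
have [y [uy wy]] : exists y : word A, approximates th u y /\ infix (val w) (val y).
  have nw := approx_word th w.
  case: wu => [->|[a ->]|[b ->]|[a [b ->]]].
  - by exists w; split => //; exact: infix_refl.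
  - have [xa na] := approx_ex th a; exists (xa * w); split; first exact: approxM.
    exact: suffix_infix.
  - have [xb nb] := approx_ex th b; exists (w * xb); split; first exact: approxM.
    exact: prefix_infix.
  - have [xa na] := approx_ex th a; have [xb nb] := approx_ex th b.
    exists (xa * w * xb); split; first by apply: approxM => //; exact: approxM.
    by apply/infixP; exists (val xa), (val xb); rewrite /= catA.
by have [_ _ <-] := Hth _ _ (approx_eq uy ux).
Qed.

Lemma infix_is_factor (w x : word A) : infix (val w) (val x) ->
  is_factor (free_proV_word V w) (free_proV_word V x).
Proof.
have wM (y z : word A) : free_proV_word V (y * z) = free_proV_word V y * free_proV_word V z.
  apply: approx_separated => th; exists (y * z); split; first exact: approx_word.
  by apply: approxM; exact: approx_word.
move=> /infixP[p [s e]].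
case: p e => [|a p] e; case: s e => [|b s] e.
- by constructor 1; congr free_proV_word; apply: val_inj; rewrite e cats0.
- constructor 3; exists (free_proV_word V (exist _ (b :: s) isT)); rewrite -wM.
  by congr free_proV_word; apply: val_inj; rewrite e.
- constructor 2; exists (free_proV_word V (exist _ (a :: p) isT)); rewrite -wM.
  by congr free_proV_word; apply: val_inj; rewrite e cats0.
- constructor 4; exists (free_proV_word V (exist _ (a :: p) isT)),
    (free_proV_word V (exist _ (b :: s) isT)); rewrite -!wM.
  by congr free_proV_word; apply: val_inj; rewrite e /= -catA.
Qed.

(** Words closer to [u] have the same short factors as [x], so [u] is a limit of multiples of [w],
    and these form a closed set. *)
Lemma approx_factor N th u (w x : word A) : refines_test N th ->
  infix (val w) (val x) -> approximates th u x -> (size (val w) <= N)%N ->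
  is_factor (free_proV_word V w) u.
Proof.
move=> Hth wx ux sw.
apply: (closed_approx hV (@is_factor_closed (free_proV V A) (free_proV_word V w))) => th'.
have [th2 H] := vquot_meet hV th th'; have [y uy] := approx_ex th2 u.
exists (free_proV_word V y); last first.
  by apply: esym; apply: (approx_sub _ uy) => a b /H[].
apply: infix_is_factor.
have uy' : approximates th u y by apply: (approx_sub _ uy) => a b /H[].
by have [_ _ <-] := Hth _ _ (approx_eq ux uy').
Qed.

Lemma idempotent_approx_size N th e (x : word A) : refines_test N th ->
  e * e = e -> approximates th e x -> (N <= size (val x))%N.
Proof.
move=> Hth ee ex; have exx := approxM ex ex; rewrite ee in exx.
have [h _ _] := Hth _ _ (approx_eq exx ex).
by apply: take_idem_size h; exact: word_size.
Qed.

Variable X : subshift A.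

Lemma mirage_is_factor u v : is_factor v u -> mirage V X u -> mirage V X v.
Proof. by move=> vu Xu w wv; apply: Xu; exact: is_factor_trans vu. Qed.

Lemma mirage_approx N th u (x w : word A) : refines_test N th -> mirage V X u ->
  approximates th u x -> infix (val w) (val x) -> (size (val w) <= N)%N -> language X w.
Proof. by move=> Hth Xu ux wx sw; apply: Xu; exact: approx_factor ux sw. Qed.

(** Whether a given word is a factor of [u] is decided by a single coordinate of [u]. *)
Lemma mirage_closed : closed (mirage V X).
Proof.
move=> u cu w wu.
have [th Hth] := vquot_test A hLSl (size (val w)).
have [v [Xv /= evu]] := cu _ (nbhs_coord (f := id) th u (fun x => @cvg_id _ (nbhs x))).
have [x ux] := approx_ex th u; have vx : approximates th v x := etrans evu ux.
exact: mirage_approx Hth Xv vx (factor_approx Hth wu ux (leqnn _)) (leqnn _).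
Qed.

(** Writing [u v = u f v], an approximating word [x z y] has a long middle part [z]. A short factor
    then lies in [x z] or in [z y], which approximate [u] and [v]. *)
Lemma mirage_mul u v f : f * f = f -> u * f = u -> f * v = v ->
  mirage V X u -> mirage V X v -> mirage V X (u * v).
Proof.
move=> ff uf fv Xu Xv w wuv.
have [th Hth] := vquot_test A hLSl (size (val w)).
have [x nx] := approx_ex th u; have [y ny] := approx_ex th v; have [z nz] := approx_ex th f.
have sz := idempotent_approx_size Hth ff nz.
have nxz := approxM nx nz; rewrite uf in nxz; have nzy := approxM nz ny; rewrite fv in nzy.
have := factor_approx Hth wuv (approxM nx nzy) (leqnn _).
move=> /(infix_cat3 sz)[h|h].
  exact: (mirage_approx Hth Xu nxz h (leqnn _)).
exact: (mirage_approx Hth Xv nzy h (leqnn _)).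
Qed.

Lemma mirage_subcategory : compact_subcategory (mirage_obj V X) (mirage_arr V X).
Proof.
split.
- apply: (preimage_closed _ mirage_closed) => e _; exact: set_val_continuous.
- apply: (preimage_closed _ mirage_closed) => a _; exact: karoubi_mid_continuous.
- move=> a Xa; apply: mirage_is_factor Xa; rewrite -(karoubi_muler a).
  by constructor 2; exists (karoubi_mid a).
- move=> a Xa; apply: mirage_is_factor Xa; rewrite -(karoubi_mulel a).
  by constructor 3; exists (karoubi_mid a).
- by [].
- move=> a b h Xa Xb; apply: (mirage_mul (f := (val a).2)) => //.
  + by case: (set_valP a).
  + exact: karoubi_muler.
  + by rewrite (congr1 val h : (val a).2 = (val b).1.1) karoubi_mulel.
Qed.
End Mirage.

Import GRing.Theory Num.Theory.

(** * Sliding block codes between subshifts *)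

Definition occ (A : finType) (x : full_shift A) (j : int) (n : nat) : seq A :=
  mkseq (fun k : nat => x (j + k%:Z)%R) n.

Lemma size_occ (A : finType) (x : full_shift A) j n : size (occ x j n) = n.
Proof. exact: size_mkseq. Qed.

Lemma occ_cat (A : finType) (x : full_shift A) j m n :
  occ x j (m + n) = occ x j m ++ occ x (j + m%:Z)%R n.
Proof.
rewrite /occ /mkseq iotaD map_cat add0n; congr (_ ++ _).
rewrite -[m in iota m n]addn0 iotaDl -map_comp; apply: eq_map => k /=.
by rewrite PoszD addrA.
Qed.

Lemma occ_sub (A : finType) (x : full_shift A) j n (s1 s2 s3 : seq A) :
  s1 ++ s2 ++ s3 = occ x j n -> s2 = occ x (j + (size s1)%:Z)%R (size s2).
Proof.
move=> e; have := congr1 size e; rewrite size_occ !size_cat => sz.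
move: e; rewrite -sz !occ_cat => /eqP; rewrite eqseq_cat ?size_occ // => /andP[_].
by rewrite eqseq_cat ?size_occ // => /andP[/eqP].
Qed.

Definition shift_by (A : finType) (j : int) (x : full_shift A) : full_shift A :=
  fun i => x (i + j)%R.

Lemma shift_byD (A : finType) (i j : int) (x : full_shift A) :
  shift_by i (shift_by j x) = shift_by (i + j)%R x.
Proof. by apply: functional_extensionality_dep => k; rewrite /shift_by addrA. Qed.

Lemma shift_by0 (A : finType) (x : full_shift A) : shift_by 0%R x = x.
Proof. by apply: functional_extensionality_dep => k; rewrite /shift_by addr0. Qed.

Lemma shift_subshift (A : finType) (X : subshift A) (j : int) x :
  subshift_set X x -> subshift_set X (shift_by j x).
Proof.
have pos (n : nat) y : subshift_set X y -> subshift_set X (shift_by n y).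
  elim: n y => [|n IH] y Xy; first by rewrite shift_by0.
  have -> : shift_by n.+1 y = shift_by n (shift_by 1%R y).
    by rewrite shift_byD -PoszD addn1.
  by apply: IH; rewrite -(subshift_shift X); exists y.
(* Backward shifts rely on the surjectivity of the shift on [X]. *)
have neg (n : nat) y : subshift_set X y -> subshift_set X (shift_by (- n%:Z)%R y).
  elim: n y => [|n IH] y Xy; first by rewrite oppr0 shift_by0.
  move: (Xy); rewrite -{1}(subshift_shift X) => -[z Xz zy].
  have -> : shift_by (- n.+1%:Z)%R y = shift_by (- n%:Z)%R z.
    rewrite -zy -[shift_map z]/(shift_by 1%R z) shift_byD; congr (shift_by _ z).
    by rewrite -addn1 PoszD opprD -addrA addNr addr0.
  exact: IH.
case: (intP j) => [|n|n] Xx; [by rewrite shift_by0| exact: pos | exact: neg].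
Qed.

Section BlockMap.
Variables (A B : finType) (X : subshift A) (Y : subshift B) (f : X -> Y).
Hypothesis fc : continuous f.
Hypothesis fs : forall x x' : X, val x' = shift_map (val x) ->
  val (f x') = shift_map (val (f x)).

Lemma block_map_shift_by (x x' : X) j : val x' = shift_by j (val x) ->
  val (f x') = shift_by j (val (f x)).
Proof.
have pos (n : nat) (y y' : X) : val y' = shift_by n (val y) ->
    val (f y') = shift_by n (val (f y)).
  elim: n y y' => [|n IH] y y' e.
    rewrite [RHS]shift_by0; congr (val (f _)); apply: val_inj.
    by rewrite e [LHS]shift_by0.
  pose z : X := SigSub (mem_set (shift_subshift 1%R (set_valP y))).
  have ez : val z = shift_map (val y) by [].
  have e' : val y' = shift_by n (val z) by rewrite e shift_byD -PoszD addn1.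
  by rewrite (IH _ _ e') (fs ez) -[shift_map _]/(shift_by 1%R _) shift_byD -PoszD addn1.
case: (intP j) => [|n|n] e; [exact: (pos 0%N)|exact: pos|].
have e' : val x = shift_by n.+1 (val x') by rewrite e shift_byD addrN shift_by0.
by rewrite (pos _ _ _ e') shift_byD addNr shift_by0.
Qed.

Lemma coordinate_continuous (C : finType) (Z : subshift C) k :
  continuous (fun x : Z => val x k : discrete_topology C).
Proof.
apply: (@continuous_compo _ _ _ (@set_val _ Z) (fun x : full_shift C => x k : discrete_topology C)).
  exact: set_val_continuous.
exact: (@proj_continuous int (fun=> discrete_topology C) k).
Qed.

Lemma compact_subshift (C : finType) (Z : subshift C) : compact [set: Z].
Proof.
have cC (k : int) : compact [set: discrete_topology C].
  by apply: finite_compact; exact: finite_finset.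
apply: compact_set_type; apply: (subclosed_compact (@subshift_closed C Z)).
  exact: (@tychonoff int (fun=> discrete_topology C) (fun=> setT) cC).
by [].
Qed.

Lemma nbhs_discrete (T : topologicalType) (C : choiceType)
    (h : T -> discrete_topology C) (t : T) :
  continuous h -> nbhs t [set t' | h t' = h t].
Proof. by move=> ch; exact: (ch t _ (discrete_set1 _)). Qed.

(** If no radius worked, pairs agreeing on ever larger windows but with different image letters
    would accumulate at a diagonal point [(c, c)], against the continuity of [f] at [c]. *)
Lemma curtis_lyndon_hedlund0 : exists m : nat, forall x x' : X,
  (forall k : int, (`|k| <= m)%N -> val x k = val x' k) ->
  val (f x) 0%R = val (f x') 0%R.
Proof.
apply: contrapT => H.
have {}H (m : nat) : exists p : X * X,
    (forall k : int, (`|k| <= m)%N -> val p.1 k = val p.2 k) /\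
    val (f p.1) 0%R <> val (f p.2) 0%R.
  apply: contrapT => H'; apply: H; exists m => x x' e; apply: contrapT => ne.
  by apply: H'; exists (x, x').
pose p m : X * X := projT1 (cid (H m)).
have hp m : _ := projT2 (cid (H m)); rewrite -/(p _) in hp.
have cXX := compact_setTX (@compact_subshift _ X) (@compact_subshift _ X).
have [[c c'] [_ cl]] := cXX (p @ \oo) _ (@filterT _ (p @ \oo) _).
have ecc' : c = c'.
  apply: val_inj; apply: functional_extensionality_dep => k.
  have F : (p @ \oo) [set q : X * X | val q.1 k = val q.2 k].
    by exists `|k|%N => // m /= km; exact: (hp m).1.
  have ck := @coordinate_continuous _ X k.
  have N1 := nbhs_discrete (c, c') (continuous_compo (@continuous_fst X X) ck).
  have N2 := nbhs_discrete (c, c') (continuous_compo (@continuous_snd X X) ck).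
  have [q [e [e1 e2]]] := cl _ _ F (filterI N1 N2).
  exact: etrans (esym e1) (etrans e e2).
have cf0 : continuous (fun x => val (f x) 0%R : discrete_topology B).
  exact: (continuous_compo fc (@coordinate_continuous _ Y 0%R)).
have F : (p @ \oo) [set q : X * X | val (f q.1) 0%R <> val (f q.2) 0%R].
  by exists 0%N => // m _; exact: (hp m).2.
have N1 := nbhs_discrete (c, c') (continuous_compo (@continuous_fst X X) cf0).
have N2 := nbhs_discrete (c, c') (continuous_compo (@continuous_snd X X) cf0).
have [q [ne [e1 e2]]] := cl _ _ F (filterI N1 N2).
by apply: ne; rewrite [LHS]e1 [RHS]e2 /= ecc'.
Qed.

Lemma curtis_lyndon_hedlund : exists m : nat, forall (x x' : X) (j j' : int),
  (forall k : int, (`|k| <= m)%N -> val x (k + j)%R = val x' (k + j')%R) ->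
  val (f x) j = val (f x') j'.
Proof.
have [m H] := curtis_lyndon_hedlund0; exists m => x x' j j' e.
pose sh (z : X) i : X := SigSub (mem_set (shift_subshift i (set_valP z))).
have sE z i : val (f z) i = val (f (sh z i)) 0%R.
  by rewrite (@block_map_shift_by z (sh z i) i) // /shift_by add0r.
by rewrite (sE x j) (sE x' j'); apply: H => k /e.
Qed.

Definition block_rule m (phi : seq A -> A -> seq A -> B) :=
  local_rule m phi /\
  forall (x : X) j l a r, rev (take m l) ++ a :: take m r = occ (val x) j m.*2.+1 ->
    phi l a r = val (f x) (j + m%:Z)%R.

Lemma block_rule_ex : exists m0, forall m, (m0 <= m)%N -> exists phi, block_rule m phi.
Proof.
have [m0 H] := curtis_lyndon_hedlund; exists m0 => m m0m.
pose E l a r (p : X * int) := rev (take m l) ++ a :: take m r = occ (val p.1) p.2 m.*2.+1.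
have [x0 Xx0] := subshift_nonempty X; pose z0 : X := SigSub (mem_set Xx0).
(* The occurrence is chosen from the truncated window alone, which makes [phi] local. Windows
   foreign to [X] receive an arbitrary letter, taken from the image of [z0]. *)
pose phi l a r := if pselect (exists p, E l a r p) is left h
  then let p := projT1 (cid h) in val (f p.1) (p.2 + m%:Z)%R else val (f z0) 0%R.
exists phi; split => [l l' a r r' el er|x j l a r e].
  by rewrite /phi /E el er.
rewrite /phi; case: pselect => [h|[]]; last by exists (x, j).
have := projT2 (cid h); set p := projT1 _; rewrite /E e /= => ep.
apply/esym; apply: H => k km.
have : ((k + m%:Z)%R >= 0)%R by lia.
case ek : (k + m%:Z)%R => [n|] // _.
have ln : (n < m.*2.+1)%N by lia.
have en i : (k + (i + m%:Z) = i + n%:Z)%R by rewrite -ek; lia.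
rewrite !en.
have a0 : A := val x 0%R.
have := congr1 (nth a0 ^~ n) ep; rewrite /occ !nth_mkseq //.
Qed.
End BlockMap.

Section RuleOccurrence.
Variables (A B : finType) (X : subshift A) (Y : subshift B) (f : X -> Y).
Variables (m : nat) (phi : seq A -> A -> seq A -> B).
Hypothesis hphi : block_rule f m phi.

(** The words [y1] and [y3] already provide [m] letters of context, so [l] and [r] are arbitrary. *)
Lemma block_code_occ (x : X) j n l r (y1 y2 y3 : seq A) :
  y1 ++ y2 ++ y3 = occ (val x) j n -> (m <= size y1)%N -> (m <= size y3)%N ->
  block_code phi (catrev y1 l) y2 (y3 ++ r) =
  occ (val (f x)) (j + (size y1)%:Z)%R (size y2).
Proof.
elim: y2 y1 => [|a y2 IH] y1 // e s1 s3.
rewrite [LHS]/= -[(size (a :: y2))]add1n occ_cat [RHS]/=; congr (_ :: _); last first.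
  have := IH (rcons y1 a); rewrite cat_rcons size_rcons => /(_ e (leqW s1) s3).
  rewrite -[catrev (rcons _ _) _]/(catrev _ _) catrevE rev_rcons /= -catrevE => ->.
  by rewrite -addn1 PoszD addrA.
have [_ spec] := hphi.
pose u := drop (size y1 - m) y1.
have su : size u = m by rewrite size_drop; lia.
have eu : rev (take m (catrev y1 l)) = u.
  by rewrite catrevE take_catl ?size_rev // take_rev revK.
have ew : take m (y2 ++ y3 ++ r) = take m (y2 ++ y3).
  by rewrite catA take_catl // size_cat (leq_trans s3) // leq_addl.
rewrite (spec x (j + (size y1 - m)%:Z)%R).
  by rewrite addr0 -addrA -PoszD subnK.
rewrite eu ew.
have := @occ_sub _ (val x) j n (take (size y1 - m) y1)
  (u ++ a :: take m (y2 ++ y3)) (drop m (y2 ++ y3)).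
rewrite size_takel ?leq_subr // => ->.
  congr occ; rewrite size_cat su /= size_takel; first by rewrite addnS addnn.
  by rewrite size_cat (leq_trans s3) // leq_addl.
by rewrite -catA /= cat_take_drop catA cat_take_drop.
Qed.
End RuleOccurrence.

(** * The functor induced by a block code *)

Section RuleWords.
Variables (A B : finType) (X : subshift A) (Y : subshift B) (f : X -> Y).
Variables (m : nat) (phi : seq A -> A -> seq A -> B).
Hypothesis hphi : block_rule f m phi.

(** The factor [w] is the code of a factor [y2] of [y]. With [m] letters added on each side, [y2]
    becomes a factor of [x ++ y ++ z] that occurs in [X]. *)
Lemma infix_block_code (x y z : seq A) (w : seq B) :
  (m <= size x)%N -> (m <= size z)%N -> infix w (block_code phi (rev x) y z) ->
  (forall t, infix t (x ++ y ++ z) -> size t = (m + size w + m)%N ->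
     exists (x0 : X) (j : int), t = occ (val x0) j (size t)) ->
  exists (x0 : X) (j : int), w = occ (val (f x0)) j (size w).
Proof.
move=> sx sz /infixP[p [s e]] H.
have se : (size y = size p + (size w + size s))%N.
  by rewrite -(size_code phi (rev x) y z) e !size_cat.
pose y1 := take (size p) y; pose y2 := take (size w) (drop (size p) y).
pose y3 := drop (size w) (drop (size p) y).
have ey : y = y1 ++ y2 ++ y3 by rewrite !cat_take_drop.
have s1 : size y1 = size p by rewrite size_takel // se leq_addr.
have s2 : size y2 = size w by rewrite size_takel // size_drop se addKn leq_addr.
have {e} : w = block_code phi (catrev y1 (rev x)) y2 (y3 ++ z).
  move: e; rewrite [in LHS]ey code_cat => /eqP; rewrite eqseq_cat ?size_code // => /andP[_].
  by rewrite code_cat eqseq_cat ?size_code // => /andP[/eqP->].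
pose t1 := drop (size p + size x - m) (x ++ y1); pose t3 := take m (y3 ++ z).
have st1 : size t1 = m by rewrite size_drop size_cat s1; lia.
have st3 : size t3 = m by rewrite size_takel // size_cat (leq_trans sz) ?leq_addl.
pose u1 := take (size p + size x - m) (x ++ y1); pose u3 := drop m (y3 ++ z).
have e1 : x ++ y1 = u1 ++ t1 by rewrite cat_take_drop.
have e3 : y3 ++ z = t3 ++ u3 by rewrite cat_take_drop.
have -> : catrev y1 (rev x) = catrev t1 (rev u1) by rewrite !catrevE -!rev_cat e1.
rewrite e3.
have [||x0 [j et]] := H (t1 ++ y2 ++ t3).
- apply/infixP; exists u1, u3.
  by rewrite ey -!catA e3 catA e1 -!catA.
- by rewrite !size_cat st1 st3 s2 addnA.
rewrite (block_code_occ hphi _ _ et) ?st1 ?st3 // s2 => ->.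
by rewrite size_occ; exists x0, (j + m%:Z)%R.
Qed.
End RuleWords.

(** * Inverse block codes on words *)

Section InverseRules.
Variables (A B : finType) (X : subshift A) (Y : subshift B) (f : X -> Y) (g : Y -> X).
Hypothesis fK : cancel f g.
Variables (m : nat) (phi : seq A -> A -> seq A -> B) (psi : seq B -> B -> seq B -> A).
Hypotheses (hphi : block_rule f m phi) (hpsi : block_rule g m psi).

(** Each letter of [y] has [2m] letters of [x ++ y ++ z] on either side, and this window occurs in
    [X]. Its code is a window of radius [m] around the coded letter, from which [psi] recovers the
    letter because [g] inverts [f]. *)
Lemma block_code_inverse (x y z : seq A) :
  (m.*2 <= size x)%N -> (m.*2 <= size z)%N ->
  take m (y ++ z) = take m x -> take m (rev (x ++ y)) = take m (rev z) ->
  (forall t, infix t (x ++ y ++ z) -> size t = (m.*2 + m.*2).+1 ->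
     exists (x0 : X) (j : int), t = occ (val x0) j (size t)) ->
  block_code psi (rev (block_code phi (rev x) x x)) (block_code phi (rev x) y z)
    (block_code phi (rev z) z z) = y.
Proof.
move=> sx sz yz xy H; have [loc spec] := hphi; have [loc' spec'] := hpsi.
have mx : (m <= size x)%N by rewrite (leq_trans _ sx) // -addnn leq_addr.
have mz : (m <= size z)%N by rewrite (leq_trans _ sz) // -addnn leq_addr.
set P := block_code phi _ x x; set Q := block_code phi _ y z; set R := block_code phi _ z z.
(* [P] and [R] were computed in the contexts [x x] and [z z]. The hypotheses say that [y z] begins
   like [x] and that [x y] ends like [z], so the true contexts give the same codes. *)
have PQR : block_code phi (rev x) (x ++ y ++ z) z = P ++ Q ++ R.
  rewrite code_cat code_cat; congr (_ ++ (_ ++ _)).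
  - apply: (code_local _ loc) => //; rewrite take_catl ?yz //.
    by rewrite size_cat (leq_trans mz) // leq_addl.
  - apply: (code_local _ loc); last by rewrite take_catl.
    by rewrite catrevE take_catl // size_rev.
  - apply: (code_local _ loc) => //.
    rewrite !catrevE catA -rev_cat take_catl ?xy // size_rev size_cat.
    by rewrite (leq_trans mx) // leq_addr.
have sQ : size (block_code psi (rev P) Q R) = size y by rewrite !size_code.
have [x00 _] := subshift_nonempty X; pose a0 : A := x00 0%R.
apply: (@eq_from_nth _ a0) => // i; rewrite sQ => iy.
set a := nth a0 y i.
pose y1 := take i y; pose y2 := drop i.+1 y.
have ey : y = y1 ++ a :: y2 by rewrite -drop_nth // cat_take_drop.
have sy1 : size y1 = i by rewrite size_takel // ltnW.
(* The window around the letter at position [i] of [y] starts [2m] places before it in [x ++ y]. *)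
pose k := (size x + i - m.*2)%N.
pose s1 := take k (x ++ y1); pose t1 := drop k (x ++ y1).
have e1 : x ++ y1 = s1 ++ t1 by rewrite cat_take_drop.
have st1 : size t1 = m.*2 by rewrite size_drop size_cat sy1 /k; lia.
pose t3 := take m.*2 (y2 ++ z); pose s3 := drop m.*2 (y2 ++ z).
have e3 : y2 ++ z = t3 ++ s3 by rewrite cat_take_drop.
have st3 : size t3 = m.*2 by rewrite size_takel // size_cat (leq_trans sz) ?leq_addl.
have [||x0 [j]] := H (t1 ++ a :: t3).
- by apply/infixP; exists s1, s3; rewrite ey -!catA /= e3 catA e1 -!catA.
- by rewrite size_cat /= st1 st3 addnS.
pose t1a := take m t1; pose t1b := drop m t1; pose t3a := take m t3; pose t3b := drop m t3.
have st1a : size t1a = m by rewrite size_takel // st1 -addnn leq_addr.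
have st1b : size t1b = m by rewrite size_drop st1 -addnn addnK.
have st3a : size t3a = m by rewrite size_takel // st3 -addnn leq_addr.
have st3b : size t3b = m by rewrite size_drop st3 -addnn addnK.
have -> : t1 ++ a :: t3 = t1a ++ (t1b ++ a :: t3a) ++ t3b.
  by rewrite -!catA /= cat_take_drop catA cat_take_drop.
move=> et.
have et' : t1a ++ (t1b ++ a :: t3a) ++ t3b = (t1a ++ t1b) ++ [:: a] ++ (t3a ++ t3b).
  by rewrite -!catA.
have ha : [:: a] = occ (val x0) (j + (m + m)%:Z)%R 1.
  by rewrite et' in et; rewrite (occ_sub et) /= size_cat st1a st1b.
have {ha} ha : a = val x0 (j + (m + m)%:Z)%R.
  by case: ha => ->; congr (val x0 _); exact: addr0.
have c2 := block_code_occ hphi (rev s1) (s3 ++ z) et.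
rewrite st1a st3b leqnn in c2; have {}c2 := c2 isT isT.
set D := block_code _ _ _ _ in c2.
have sD : size D = m.*2.+1 by rewrite c2 size_occ size_cat /= st1b st3a addnS addnn.
(* Coding consumes [m] letters on each side, so [D] starts [m] places before the coded letter. *)
have PD : exists c1 c3, [/\ P ++ Q ++ R = c1 ++ D ++ c3 & size c1 = (size x + i - m)%N].
  rewrite -PQR.
  have -> : x ++ y ++ z = (s1 ++ t1a) ++ (t1b ++ a :: t3a) ++ (t3b ++ s3).
    rewrite ey -!catA /= e3 catA e1 -!catA; congr (s1 ++ _).
    by rewrite -{1}(cat_take_drop m t1) -{1}(cat_take_drop m t3) -!catA.
  rewrite code_cat [X in _ ++ X]code_cat.
  exists (block_code phi (rev x) (s1 ++ t1a) (((t1b ++ a :: t3a) ++ t3b ++ s3) ++ z)).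
  eexists; split; last first.
    by rewrite size_code size_cat size_takel ?st1a ?size_cat ?sy1 /k; lia.
  congr (_ ++ (_ ++ _)); rewrite -catA; apply: (code_local _ loc) => //.
  rewrite !catrevE rev_cat -!catA !take_catl // ?size_rev ?st1a //.
have [c1 [c3 [ePQR sc1]]] := PD.
pose d1 := take m D; pose d2 := drop m.+1 D.
have [b eD] : exists b, D = d1 ++ b :: d2.
  have : (m < size D)%N by rewrite sD -addnn; lia.
  case eDD : (D) => [|b0 D'] // lt; exists (nth b0 D m).
  by rewrite -drop_nth ?cat_take_drop // eDD.
have sd1 : size d1 = m by rewrite size_takel // sD; lia.
have sd2 : size d2 = m by rewrite size_drop sD; lia.
pose Q1 := take i Q; pose Q2 := drop i.+1 Q.
have [b' eQ] : exists b', Q = Q1 ++ b' :: Q2.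
  have lt : (i < size Q)%N by rewrite size_code.
  case eQQ : (Q) lt => [|b0 Q'] // lt; exists (nth b0 Q i).
  by rewrite -drop_nth ?cat_take_drop // eQQ.
have sQ1 : size Q1 = i by rewrite size_takel // size_code ltnW.
have sP : size P = size x by rewrite size_code.
have : (P ++ Q1) ++ b' :: (Q2 ++ R) = (c1 ++ d1) ++ b :: (d2 ++ c3).
  by move: ePQR; rewrite eQ eD -!catA.
move=> /eqP; rewrite eqseq_cat; last by rewrite !size_cat sP sQ1 sc1 sd1; lia.
move=> /andP[/eqP eL /eqP[eb eR]].
rewrite [in X in nth _ X _]eQ code_cat nth_cat size_code sQ1 ltnn subnn /=.
rewrite ha (spec' (f x0) (j + m%:Z)%R); first by rewrite fK PoszD addrA.
have -> : take m (catrev Q1 (rev P)) = rev d1.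
  by rewrite catrevE -rev_cat eL rev_cat take_size_cat ?size_rev.
rewrite revK eR take_size_cat // eb -eD c2 size_cat /= st1b st3a.
by rewrite addnS addnn.
Qed.
End InverseRules.

(** * Extension of block codes to pseudowords *)

Section Extension.
Variables (V : finSemigroupType -> Prop) (A B : finType).
Hypothesis hV : pseudovariety V.
Hypothesis hLSl : forall S : finSemigroupType, LSl S -> V S.
Hypothesis hVD : forall S : finSemigroupType, V S <-> semidirect_var V Dvar S.
Variables (m : nat) (phi : seq A -> A -> seq A -> B).
Hypothesis loc : local_rule m phi.
Implicit Types (u v e f g : free_proV V A) (th : vquot V (word B)).

Definition code_between (x y z : word A) : word B :=
  code_word phi (rev (val x)) y (val z).

(** The middle word is handled by [code_uniform]. The outer words matter only through their [m]
    letters next to it, which a testable quotient records. *)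
Lemma code_between_uniform th : exists th' : vquot V (word A),
  forall x x' y y' z z', th' x x' -> th' y y' -> th' z z' ->
    th (code_between x y z) (code_between x' y' z').
Proof.
have [th1 H1] := code_uniform hV hLSl hVD loc th.
have [th2 H2] := vquot_test A hLSl m.
have [th' H] := vquot_meet hV th1 th2.
exists th' => x x' y y' z z' /H[_ /H2[_ ex _]] /H[/H1 ey _] /H[_ /H2[ez _ _]].
rewrite (_ : code_between x' y' z' = code_word phi (rev (val x)) y' (val z)) ?ey //.
by apply: val_inj; exact: (code_local _ loc).
Qed.

Definition modulus th : vquot V (word A) := projT1 (cid (code_between_uniform th)).

Lemma modulusP th x x' y y' z z' :
  modulus th x x' -> modulus th y y' -> modulus th z z' ->
  th (code_between x y z) (code_between x' y' z').
Proof. exact: (projT2 (cid (code_between_uniform th))). Qed.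

Definition coded_coord e u f th : quot th :=
  \pi_(quot th) (code_between (repr (val e (modulus th)))
    (repr (val u (modulus th))) (repr (val f (modulus th)))).

Lemma coded_coordE th e u f x y z :
  approximates (modulus th) e x -> approximates (modulus th) u y ->
  approximates (modulus th) f z ->
  coded_coord e u f th = \pi_(quot th) (code_between x y z).
Proof.
have r v (w : word A) : approximates (modulus th) v w ->
    modulus th (repr (val v (modulus th))) w.
  by apply: approx_eq; rewrite /approximates reprK.
by move=> /r ex /r uy /r fz; apply/eqmodP; exact: modulusP.
Qed.

Lemma coded_compatible e u f :
  @compatible V (word B) (fun th => coded_coord e u f th).
Proof.
move=> th th' sth w.
have [t H] := vquot_meet hV (modulus th) (modulus th').
have [x ex] := approx_ex t e; have [y uy] := approx_ex t u; have [z fz] := approx_ex t f.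
have s1 a b : t a b -> modulus th a b by case/H.
have s2 a b : t a b -> modulus th' a b by case/H.
rewrite (coded_coordE (approx_sub s1 ex) (approx_sub s1 uy) (approx_sub s1 fz)).
rewrite (coded_coordE (approx_sub s2 ex) (approx_sub s2 uy) (approx_sub s2 fz)).
by move=> /eqmodP h; apply/eqmodP; exact: sth.
Qed.

(* The image of [u] in the context of [e] on its left and [f] on its right. *)
Definition coded e u f : free_proV V B := SigSub (mem_set (@coded_compatible e u f)).

Lemma coded_approx th e u f x y z :
  approximates (modulus th) e x -> approximates (modulus th) u y ->
  approximates (modulus th) f z ->
  approximates th (coded e u f) (code_between x y z).
Proof. exact: coded_coordE. Qed.

Lemma coded_continuous (T : topologicalType) (e u f : T -> free_proV V A) :
  continuous e -> continuous u -> continuous f ->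
  continuous (fun t => coded (e t) (u t) (f t)).
Proof.
move=> ce cu cf; apply: continuous_approx => t th.
apply: filterS (filterI (nbhs_coord (modulus th) t ce)
  (filterI (nbhs_coord (modulus th) t cu) (nbhs_coord (modulus th) t cf))).
move=> t' [e1 [e2 e3]].
have [x ex] := approx_ex (modulus th) (e t).
have [y uy] := approx_ex (modulus th) (u t).
have [z fz] := approx_ex (modulus th) (f t).
apply: etrans (esym (coded_approx ex uy fz)).
by apply: coded_approx; [exact: etrans e1 ex|exact: etrans e2 uy|exact: etrans e3 fz].
Qed.

Lemma coded_mul e f g u v : f * f = f -> u * f = u -> f * v = v ->
  coded e (u * v) g = coded e u f * coded f v g.
Proof.
move=> ff uf fv; apply: approx_separated => th.
have [th2 H2] := vquot_test A hLSl m.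
have [t H] := vquot_meet hV (modulus th) th2.
have s1 a b : t a b -> modulus th a b by case/H.
have Ht : refines_test m t by move=> a b /H[_ /H2].
have [x ex] := approx_ex t e; have [y fy] := approx_ex t f; have [z gz] := approx_ex t g.
have [p up] := approx_ex t u; have [q vq] := approx_ex t v.
exists (code_between x (p * q) z); split.
  by apply: coded_approx; apply: (approx_sub s1) => //; exact: approxM.
have sy := idempotent_approx_size Ht ff fy.
have yq := approxM fy vq; rewrite fv in yq.
have py := approxM up fy; rewrite uf in py.
(* The word [y] has at least [m] letters, [q] begins like [y q] and [p] ends like [p y]. Hence [y]
   is a correct context for both [p] and [q]. *)
rewrite (_ : code_between x (p * q) z = code_between x p y * code_between y q z).
  by apply: approxM; apply: coded_approx; exact: (approx_sub s1).
apply: val_inj => /=; rewrite code_cat; congr (_ ++ _).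
  apply: (code_local _ loc) => //.
  have [e1 _ _] := Ht _ _ (approx_eq vq yq).
  rewrite -take_cat_take e1 take_cat_take /= -catA take_catl //.
apply: (code_local _ loc) => //.
have [_ e1 _] := Ht _ _ (approx_eq up py).
rewrite catrevE -take_cat_take e1 take_cat_take /= rev_cat -catA take_catl //.
by rewrite size_rev.
Qed.

Lemma coded_idempotent e : e * e = e -> coded e e e * coded e e e = coded e e e.
Proof. by move=> ee; rewrite -coded_mul // ee. Qed.

Variables (X : subshift A) (Y : subshift B) (h : X -> Y).
Hypothesis hphi : block_rule h m phi.

(** A factor [w] of the image comes from a factor of length [m + |w| + m] of [x y z], a word that
    approximates [e u f = u]. *)
Lemma coded_mirage e u f : e * e = e -> f * f = f -> u = e * u * f ->
  mirage V X u -> mirage V Y (coded e u f).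
Proof.
move=> ee ff euf Xu w wu.
have [thB HB] := vquot_test B hLSl (size (val w)).
have [th2 H2] := vquot_test A hLSl (m + size (val w) + m)%N.
have [t H] := vquot_meet hV (modulus thB) th2.
have s1 a b : t a b -> modulus thB a b by case/H.
have Ht : refines_test (m + size (val w) + m) t by move=> a b /H[_ /H2].
have [x ex] := approx_ex t e; have [y uy] := approx_ex t u; have [z fz] := approx_ex t f.
have := factor_approx HB wu
  (coded_approx (approx_sub s1 ex) (approx_sub s1 uy) (approx_sub s1 fz)) (leqnn _).
have sx := idempotent_approx_size Ht ee ex; have sz := idempotent_approx_size Ht ff fz.
have le : (m <= m + size (val w) + m)%N by rewrite leq_addl.
move=> /(infix_block_code hphi (leq_trans le sx) (leq_trans le sz))[].
  move=> s sxyz ss; have s0 : s != [::].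
    by rewrite -size_eq0 ss -lt0n !addn_gt0 word_size orbT.
  have xyz := approxM (approxM ex uy) fz; rewrite -euf in xyz.
  have [|x0 [j [Xx0 es]]] := mirage_approx hV Ht Xu xyz (w := exist _ s s0) _ (eq_leq ss).
    by rewrite /= -catA.
  by exists (SigSub (mem_set Xx0)), j.
by move=> x0 [j ew]; exists (val (h x0)), j; split; [exact: set_valP|].
Qed.
End Extension.

Section Inverse.
Variables (V : finSemigroupType -> Prop) (A B : finType).
Hypothesis hV : pseudovariety V.
Hypothesis hLSl : forall S : finSemigroupType, LSl S -> V S.
Hypothesis hVD : forall S : finSemigroupType, V S <-> semidirect_var V Dvar S.
Variables (X : subshift A) (Y : subshift B) (h : X -> Y) (k : Y -> X).
Hypothesis hK : cancel h k.
Variables (m : nat) (phi : seq A -> A -> seq A -> B) (psi : seq B -> B -> seq B -> A).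
Hypotheses (hphi : block_rule h m phi) (hpsi : block_rule k m psi).
Let cphi := coded hV hLSl hVD (proj1 hphi).
Let cpsi := coded hV hLSl hVD (proj1 hpsi).

Lemma codedK (e u f : free_proV V A) : e * e = e -> f * f = f -> u = e * u * f ->
  mirage V X u -> cpsi (cphi e e e) (cphi e u f) (cphi f f f) = u.
Proof.
move=> ee ff euf Xu; apply: approx_separated => th.
pose th1 := modulus hV hLSl hVD (proj1 hpsi) th.
pose th2 := modulus hV hLSl hVD (proj1 hphi) th1.
(* Two successive rules of radius [m] look at [2m] letters on each side, hence at factors of length
   [4m + 1]. *)
have [th3 H3] := vquot_test A hLSl (m.*2 + m.*2).+1.
have [t' H'] := vquot_meet hV th th3; have [t H] := vquot_meet hV th2 t'.
have s1 a b : t a b -> th2 a b by case/H.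
have s2 a b : t a b -> th a b by case/H => _ /H'[].
have Ht : refines_test (m.*2 + m.*2).+1 t by move=> a b /H[_ /H'[_ /H3]].
have [x ex] := approx_ex t e; have [y uy] := approx_ex t u; have [z fz] := approx_ex t f.
exists y; split; last exact: (approx_sub s2).
have sx := idempotent_approx_size Ht ee ex; have sz := idempotent_approx_size Ht ff fz.
have ab a b c p q r (pa : approximates t a p) (qb : approximates t b q)
    (rc : approximates t c r) :=
  coded_approx (approx_sub s1 pa) (approx_sub s1 qb) (approx_sub s1 rc).
have := coded_approx (th := th)
  (ab _ _ _ _ _ _ ex ex ex) (ab _ _ _ _ _ _ ex uy fz) (ab _ _ _ _ _ _ fz fz fz).
congr (approximates th _ _); apply: val_inj => /=.
have xyz := approxM (approxM ex uy) fz; rewrite -euf in xyz.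
have [eu] : e * u = u by rewrite euf !mulgA ee.
have uf : u * f = u by rewrite euf -!mulgA ff.
have xy := approxM ex uy; rewrite eu in xy; have yz := approxM uy fz; rewrite uf in yz.
have lm : (m <= (m.*2 + m.*2).+1)%N by lia.
have lm2 : (m.*2 <= (m.*2 + m.*2).+1)%N by lia.
apply: (block_code_inverse hK hphi hpsi).
- exact: leq_trans lm2 sx.
- exact: leq_trans lm2 sz.
- have [e1 _ _] := testably_equalS lm (Ht _ _ (approx_eq yz xyz)).
  by rewrite e1 /= -catA take_catl // (leq_trans lm).
- have [_ e1 _] := testably_equalS lm (Ht _ _ (approx_eq xy xyz)).
  by rewrite e1 /= rev_cat take_catl // size_rev (leq_trans lm).
move=> s sxyz ss; have s0 : s != [::] by rewrite -size_eq0 ss.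
have [|x0 [j [Xx0 es]]] := mirage_approx hV Ht Xu xyz (w := exist _ s s0) _ (eq_leq ss).
  by rewrite /= -catA.
by exists (SigSub (mem_set Xx0)), j.
Qed.
End Inverse.

(** * The functor between the Karoubi envelopes of the mirages *)

Section Functor.
Variables (V : finSemigroupType -> Prop) (A B : finType).
Hypothesis hV : pseudovariety V.
Hypothesis hLSl : forall S : finSemigroupType, LSl S -> V S.
Hypothesis hVD : forall S : finSemigroupType, V S <-> semidirect_var V Dvar S.
Variables (X : subshift A) (Y : subshift B) (h : X -> Y).
Variables (m : nat) (phi : seq A -> A -> seq A -> B).
Hypothesis hphi : block_rule h m phi.

Let cphi := coded hV hLSl hVD (proj1 hphi).
Let C := subcategory (mirage_subcategory hV hLSl X).
Let D := subcategory (mirage_subcategory hV hLSl Y).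

Definition coded_obj (e : karoubi_obj (free_proV V A)) : karoubi_obj (free_proV V B) :=
  SigSub (mem_set (coded_idempotent hV hLSl hVD (proj1 hphi) (set_valP e))).

Lemma coded_arr_subproof (a : karoubi_arr (free_proV V A)) :
  @karoubi_arrows (free_proV V B)
    (val (coded_obj (karoubi_cod a)),
     cphi (val a).1.1 (karoubi_mid a) (val a).2,
     val (coded_obj (karoubi_dom a))).
Proof.
have [ee ff _] := set_valP a; split; first exact: set_valP.
  exact: set_valP.
rewrite /= -[LHS]/(cphi _ _ _) -!coded_mul //; try exact: karoubi_muler.
  by rewrite karoubi_mulel karoubi_muler.
all: by rewrite ?karoubi_mulel ?karoubi_muler.
Qed.

Definition coded_arr (a : karoubi_arr (free_proV V A)) : karoubi_arr (free_proV V B) :=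
  SigSub (mem_set (coded_arr_subproof a)).

Lemma coded_obj_mirage (x : obj C) : mirage_obj V Y (coded_obj (val x)).
Proof.
have ee : val (val x) * val (val x) = val (val x) := set_valP (val x).
have e3 : val (val x) = val (val x) * val (val x) * val (val x) by rewrite !ee.
exact: (coded_mirage hphi ee ee e3 (set_valP x)).
Qed.

Lemma coded_arr_mirage (a : arr C) : mirage_arr V Y (coded_arr (val a)).
Proof.
have [ee ff e] := set_valP (val a).
exact: (coded_mirage hphi ee ff e (set_valP a)).
Qed.

Definition mirage_fobj (x : obj C) : obj D := SigSub (mem_set (@coded_obj_mirage x)).
Definition mirage_farr (a : arr C) : arr D := SigSub (mem_set (@coded_arr_mirage a)).

Lemma mirage_fcompose (a b : arr C) (ab : dom a = cod b)
    (ab' : dom (mirage_farr a) = cod (mirage_farr b)) :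
  mirage_farr (compose ab) = compose ab'.
Proof.
apply: val_inj; apply: karoubi_arr_eq => //.
have fe : (val (val a)).2 = (val (val b)).1.1 := congr1 (fun x => val (val x)) ab.
have [_ ff _] := set_valP (val a).
rewrite /karoubi_mid /= [LHS](coded_mul hV hLSl hVD (proj1 hphi) _ _ ff).
- by rewrite {2}fe.
- exact: karoubi_muler.
- by rewrite fe karoubi_mulel.
Qed.

Lemma mirage_fobj_continuous : continuous mirage_fobj.
Proof.
have c : continuous (fun x : obj C => val (val x) : free_proV V A).
  exact: (continuous_compo (@set_val_continuous _ _) (@set_val_continuous _ _)).
apply: continuous_to_set_type; apply: continuous_to_set_type.
exact: coded_continuous.
Qed.

Lemma mirage_farr_continuous : continuous mirage_farr.
Proof.
have cv : continuous (fun a : arr C => val a : karoubi_arr (free_proV V A)).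
  exact: set_val_continuous.
have c1 := continuous_compo cv (@karoubi_cod_continuous _).
have c2 := continuous_compo cv (@karoubi_mid_continuous _).
have c3 := continuous_compo cv (@karoubi_dom_continuous _).
apply: continuous_to_set_type; apply: continuous_to_set_type.
apply: continuous_pair; first apply: continuous_pair; exact: coded_continuous.
Qed.

(** Kept transparent: the proof that two such functors are inverse computes their object and arrow
    maps. *)
Definition mirage_functor : compact_functor C D.
Proof.
apply: (@CompactFunctor C D mirage_fobj mirage_farr).
- by move=> a; apply: val_inj; apply: val_inj.
- by move=> a; apply: val_inj; apply: val_inj.
- by move=> x; apply: val_inj; apply: karoubi_arr_eq.
- exact: mirage_fcompose.
- exact: mirage_fobj_continuous.
- exact: mirage_farr_continuous.
Defined.
End Functor.

Lemma mirage_functorK (V : finSemigroupType -> Prop) (A B : finType)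
    (hV : pseudovariety V) (hLSl : forall S : finSemigroupType, LSl S -> V S)
    (hVD : forall S : finSemigroupType, V S <-> semidirect_var V Dvar S)
    (X : subshift A) (Y : subshift B) (h : X -> Y) (k : Y -> X) m phi psi
    (hphi : block_rule h m phi) (hpsi : block_rule k m psi) :
  cancel h k ->
  let F := mirage_functor hV hLSl hVD hphi in
  let G := mirage_functor hV hLSl hVD hpsi in
  cancel (fobj F) (fobj G) /\ cancel (farr F) (farr G).
Proof.
move=> hK F G; have KO (e : free_proV V A) : e * e = e -> mirage V X e ->
    coded hV hLSl hVD (proj1 hpsi) (coded hV hLSl hVD (proj1 hphi) e e e)
      (coded hV hLSl hVD (proj1 hphi) e e e) (coded hV hLSl hVD (proj1 hphi) e e e) = e.
  by move=> ee Xe; apply: (codedK hV hLSl hVD hK hphi hpsi) => //; rewrite !ee.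
split=> [x|a].
  apply: val_inj; apply: val_inj.
  by apply: KO; [exact: (set_valP (val x))|exact: (set_valP x)].
have [ee ff e] := set_valP (val a); have Xa : mirage V X (karoubi_mid (val a)) := set_valP a.
have H := mirage_subcategory hV hLSl X.
apply: val_inj; apply: karoubi_arr_eq.
- by apply: KO => //; exact: (sub_cod H Xa).
- exact: (codedK hV hLSl hVD hK hphi hpsi).
- by apply: KO => //; exact: (sub_dom H Xa).
Qed.

Theorem corollary5p14 (V : finSemigroupType -> Prop)
    (hV : pseudovariety V)
    (hLSl : forall S : finSemigroupType, LSl S -> V S)
    (hVD : forall S : finSemigroupType, V S <-> semidirect_var V Dvar S)
    (A B : finType) (X : subshift A) (Y : subshift B)
    (hXY : conjugate X Y) :
  exists (hX : compact_subcategory (mirage_obj V X) (mirage_arr V X))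
         (hY : compact_subcategory (mirage_obj V Y) (mirage_arr V Y)),
    isomorphic_categories (subcategory hX) (subcategory hY).
Proof.
have [f [g [fc gc fK gK fs]]] := hXY.
(* The inverse of a conjugacy commutes with the shift: [f] sends the shift [z] of [g y] to the shift
   of [y], which is [y']. *)
have gs (y y' : Y) : val y' = shift_map (val y) -> val (g y') = shift_map (val (g y)).
  move=> e; pose z : X := SigSub (mem_set (shift_subshift 1%R (set_valP (g y)))).
  have ez : val z = shift_map (val (g y)) by [].
  by rewrite -ez -(fK z); congr (val (g _)); apply: val_inj; rewrite e (fs _ _ ez) gK.
have [m1 H1] := block_rule_ex fc fs; have [m2 H2] := block_rule_ex gc gs.
(* Both rules are taken with the same radius, as the inverse argument requires. *)
have [phi hphi] := H1 (maxn m1 m2) (leq_maxl _ _).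
have [psi hpsi] := H2 (maxn m1 m2) (leq_maxr _ _).
exists (mirage_subcategory hV hLSl X), (mirage_subcategory hV hLSl Y).
exists (mirage_functor hV hLSl hVD hphi), (mirage_functor hV hLSl hVD hpsi).
have [FO FA] := mirage_functorK hV hLSl hVD hphi hpsi fK.
by have [GO GA] := mirage_functorK hV hLSl hVD hpsi hphi gK.
Qed.
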